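(* Let $r$ denote the Euclidean distance to the origin in $\mathbb{R}^3$. There exists a smooth, closed, embedded, star-shaped and strictly convex surface $\Sigma\subset\mathbb{R}^3$ such that $$|\Sigma|^{-2}\int_\Sigma r^2\,d\Sigma\;<\;\frac{1}{\omega_2}.$$
   Context: $|\Sigma|$ is the area of $\Sigma$ and $\omega_2=4\pi$ is the area of the unit sphere $\mathbb{S}^2$; the value $1/\omega_2$ is the value of the scale-invariant quantity on the left for round spheres centered at the origin. A surface is star-shaped if, for some point $p\in\mathbb{R}^3$, it is the graph of some function defined on some geodesic sphere centered at $p$ (a radial graph). Strictly convex means that both principal curvatures are positive everywhere (with the convention that round spheres have positive principal curvatures). *)

(* Defs.v *)
From HB Require Import structures.
From mathcomp Require Import all_boot all_order all_algebra.
From mathcomp Require Import all_classical all_reals all_analysis.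
Import Order.TTheory GRing.Theory Num.Theory.
Import numFieldNormedType.Exports.

Set Implicit Arguments.
Unset Strict Implicit.
Unset Printing Implicit Defensive.

Local Open Scope classical_set_scope.
Local Open Scope ring_scope.

(* The norm of the normed module 'rV[R]_3 is the sup norm: it is used here only
   for its topology and its bounded sets. Lengths and angles come from dotv. *)
Definition dotv (R : realType) n (x y : 'rV[R]_n) : R :=
  \sum_(i < n) x 0 i * y 0 i.

Definition eucl_dist (R : realType) n (x y : 'rV[R]_n) : R :=
  Num.sqrt (dotv (x - y) (x - y)).

Definition eucl_sphere (R : realType) n (p : 'rV[R]_n) (s : R) : set 'rV[R]_n :=
  [set x | eucl_dist x p = s].

(* f is of class C^k on the open set U. *)
Fixpoint Ck_on (R : realType) (V W : normedModType R) (k : nat) (U : set V)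
    (f : V -> W) : Prop :=
  if k is k'.+1 then
    (forall x, U x -> differentiable f x) /\
    (forall v, Ck_on k' U (fun x => 'D_v f x))
  else forall x, U x -> {for x, continuous f}.

Definition smooth_on (R : realType) (V W : normedModType R) (U : set V)
    (f : V -> W) : Prop := forall k, Ck_on k U f.

Definition basis2 (R : realType) (i : 'I_2) : R * R :=
  if i == 0 then (1, 0) else (0, 1).

(* The rows of jac X q are the tangent vectors X_u and X_v at q. *)
Definition jac (R : realType) (X : R * R -> 'rV[R]_3) (q : R * R) :
    'M[R]_(2, 3) :=
  \matrix_(i < 2, j < 3) ('D_(basis2 R i) X q) 0 j.

Definition first_form (R : realType) (X : R * R -> 'rV[R]_3) (q : R * R) :
    'M[R]_2 :=
  jac X q *m (jac X q)^T.

(* sqrt (E G - F ^ 2) = | X_u x X_v | *)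
Definition area_density (R : realType) (X : R * R -> 'rV[R]_3) (q : R * R) :
    R :=
  Num.sqrt (\det (first_form X q)).

(* A regular local parametrization of S: a smooth immersion of an open set U of
   the plane which is a homeomorphism onto a relatively open subset of S, the
   last two conditions saying that it is injective and relatively open. *)
Definition local_param (R : realType) (S : set 'rV[R]_3) (U : set (R * R))
    (X : R * R -> 'rV[R]_3) : Prop :=
  [/\ open U,
      smooth_on U X,
      (forall q, U q -> row_free (jac X q)),
      (forall q q', U q -> U q' -> X q = X q' -> q = q') &
      (forall W, open W -> W `<=` U ->
         exists2 O : set 'rV[R]_3, open O & X @` W = S `&` O)].

Definition embedded_surface (R : realType) (S : set 'rV[R]_3) : Prop :=
  forall p, S p -> exists U X, local_param S U X /\ (X @` U) p.

(* Closed: compact and without boundary. *)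
Definition closed_surface (R : realType) (S : set 'rV[R]_3) : Prop :=
  embedded_surface S /\ compact S.

(* The point of the graph of rho above th is the point of the ray from p
   through th at distance rho th * s from p. The values of rho outside the
   sphere are irrelevant. *)
Definition star_shaped (R : realType) (S : set 'rV[R]_3) : Prop :=
  exists (p : 'rV[R]_3) (s : R) (rho : 'rV[R]_3 -> R),
    [/\ 0 < s,
        (forall th, eucl_sphere p s th -> 0 < rho th) &
        S = [set p + rho th *: (th - p) | th in eucl_sphere p s]].

(* Union of the unbounded connected components of the complement of S. *)
Definition exterior (R : realType) (S : set 'rV[R]_3) : set 'rV[R]_3 :=
  [set x | ~ S x /\ ~ bounded_set (connected_component (~` S) x)].

Definition outward_unit_normal (R : realType) (S : set 'rV[R]_3)
    (X : R * R -> 'rV[R]_3) (q : R * R) (nu : 'rV[R]_3) : Prop :=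
  [/\ dotv nu nu = 1,
      (forall i, dotv (row i (jac X q)) nu = 0) &
      (exists2 e : R, 0 < e &
         forall t, 0 < t < e -> exterior S (X q + t *: nu))].

(* With N the Gauss map for the outward normal, <X_i, N> = 0 gives
   <X_i, N_j> = - <X_ij, N>: the form below is <dX, dN>, which is the first
   form divided by r for the round sphere of radius r. *)
Definition second_form (R : realType) (X : R * R -> 'rV[R]_3) (nu : 'rV[R]_3)
    (q : R * R) : 'M[R]_2 :=
  \matrix_(i < 2, j < 2)
    - dotv ('D_(basis2 R i) (fun q' => 'D_(basis2 R j) X q') q) nu.

(* Matrix of the shape operator in the basis (X_u, X_v). *)
Definition shape_operator (R : realType) (X : R * R -> 'rV[R]_3)
    (nu : 'rV[R]_3) (q : R * R) : 'M[R]_2 :=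
  invmx (first_form X q) *m second_form X nu q.

(* The principal curvatures at p are the eigenvalues, with multiplicity, of the
   shape operator. The pair does not depend, up to order, on the local
   parametrization in which it is computed. *)
Definition principal_curvatures (R : realType) (S : set 'rV[R]_3)
    (p : 'rV[R]_3) (k1 k2 : R) : Prop :=
  exists U X q nu,
    [/\ local_param S U X, U q, X q = p,
        outward_unit_normal S X q nu &
        char_poly (shape_operator X nu q) = ('X - k1%:P) * ('X - k2%:P)].

Definition strictly_convex (R : realType) (S : set 'rV[R]_3) : Prop :=
  forall p, S p ->
    exists k1 k2, [/\ principal_curvatures S p k1 k2, 0 < k1 & 0 < k2].

(* I is the integral over S of the continuous function f with respect to the
   area element: S is cut into finitely many pairwise disjoint Borel pieces
   X_i (A_i), each inside the image of a local parametrization X_i, and I is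
   the sum of the integrals of (f o X_i) | X_i,u x X_i,v | du dv over the A_i.
   By the change of variables formula, at most one I satisfies this. *)
Definition surface_integral (R : realType) (S : set 'rV[R]_3)
    (f : 'rV[R]_3 -> R) (I : R) : Prop :=
  exists (n : nat) (U : 'I_n -> set (R * R))
         (A : 'I_n -> set (measurableTypeR R * measurableTypeR R))
         (X : 'I_n -> R * R -> 'rV[R]_3),
    [/\ (forall i, local_param S (U i) (X i)),
        (forall i, measurable (A i) /\ A i `<=` U i),
        S = \bigcup_i (X i @` A i),
        trivIset setT (fun i => X i @` A i) &
        I%:E = (\sum_(i < n)
          \int[lebesgue_measure \x lebesgue_measure]_(q in A i)
            (f (X i q) * area_density (X i) q)%:E)%E].

Definition surface_area (R : realType) (S : set 'rV[R]_3) (a : R) : Prop :=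
  surface_integral S (fun=> 1) a.

(* Area of the unit sphere of R^3. *)
Definition omega2 (R : realType) : R := 4 * pi.

(* Main.v *)
From HB Require Import structures.
Require Import Defs.
From mathcomp Require Import all_boot all_order all_algebra.
From mathcomp Require Import all_classical all_reals all_analysis.
From mathcomp Require Import measurable_realfun.
From mathcomp Require Import ring lra.
Import Order.TTheory GRing.Theory Num.Theory.
Import numFieldNormedType.Exports.
Local Open Scope classical_set_scope.
Local Open Scope ring_scope.

Set Implicit Arguments.
Unset Strict Implicit.
Unset Printing Implicit Defensive.

(** The surface is a cube with its edges rounded off. The boundary of the cube
    [-1, 1]^3 has area 24 and moment 40, and 4 pi * 40 < 24 ^ 2: the required
    inequality holds for it with a margin of about thirteen percent, and hence
    for every smooth strictly convex surface close enough to it. The surface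
    used is the level set G = 1 of
      G x = x_0 ^ 2m + x_1 ^ 2m + x_2 ^ 2m + eps * |x| ^ 2m
    for a large m and a small eps > 0.

    Both terms of G are homogeneous of the same degree, so that everything is
    explicit in the central projection to a face of the cube. The patch over
    the face x_0 = s, with s = 1 or s = -1, is
      X (u, v) = rho (u, v) * (s, u, v),  rho = G (s, u, v) ^ (-1 / 2m),
    and the other patches are obtained by a cyclic shift of the coordinates.
    The derivatives of rho are polynomials in u, v and rho, which makes the
    patches smooth ([elementary_derive], [elementary_map_smooth]). The inverse
    of a patch divides two coordinates by the third, which makes it a
    homeomorphism onto an open part of the surface ([local_param_patch]), and
    homogeneity makes the surface a radial graph over the unit sphere
    ([star_shaped_rounded_cube]).

    The gradient N of G is normal to the patches. Differentiating the identity
    X_w . N = 0 expresses the second fundamental form through the Hessian of G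
    ([second_derivative_normal]), and this Hessian is positive definite because
    of the term with eps ([hess_gt0]). Along N no coordinate comes closer to 0,
    so that G increases and the normal ray stays outside ([exterior_normal_ray]).
    This gives positive principal curvatures ([strictly_convex_rounded_cube]).

    The six patches restricted to the unit square, with parts of its boundary
    removed to avoid repetitions, cut the surface into pieces according to the
    coordinate of largest absolute value ([image_tile], [tiles_cover],
    [tiles_disjoint]). On the square the area density is at most 1 and the
    moment density is at most 1 + u ^ 2 + v ^ 2, so that the moment is at most
    40, as for the cube ([moment_rounded_cube]). For a < 1 the density is close
    to 1 on [-a, a]^2 when m is large and eps * 3 ^ m is small, so that the area
    is close to 24 ([area_rounded_cube], [gauge_le]). The bound pi <= 7 / 2 is
    then enough to conclude. *)

(** * Two-by-two matrices *)

Lemma det2 (R : comNzRingType) (A : 'M[R]_2) :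
  \det A = A 0 0 * A 1 1 - A 0 1 * A 1 0.
Proof.
rewrite (expand_det_row _ 0) !big_ord_recl big_ord0 /cofactor !det_mx11 !mxE /=.
rewrite (_ : lift 0 0 = 1 :> 'I_2); last exact/val_inj.
rewrite (_ : lift 1 0 = 0 :> 'I_2); last exact/val_inj.
by rewrite /=; ring.
Qed.

Lemma char_poly2 (R : idomainType) (A : 'M[R]_2) (a b : R) :
  a + b = \tr A -> a * b = \det A ->
  char_poly A = ('X - a%:P) * ('X - b%:P).
Proof.
move=> ab_tr ab_det.
have s3 := size_char_poly A; have := char_poly_monic A.
have t := char_poly_trace A (ltn0Sn 1). have d := char_poly_det A.
rewrite monicE lead_coefE s3 /= => /eqP lc.
apply/polyP => -[|[|[|i]]].
- rewrite d -ab_det expr2 mulrNN !mul1r coef0M !coefB !coefX !coefC /=.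
  by rewrite !sub0r mulrNN.
- rewrite t -ab_tr mulrBl !coefB coefXM coefCM !coefB !coefX !coefC /=; ring.
- rewrite lc mulrBl !coefB coefXM coefCM !coefB !coefX !coefC /=.
  by rewrite !subr0 mulr0 subr0.
rewrite nth_default ?s3// nth_default// size_Mmonic ?monicXsubC//.
  by rewrite !size_XsubC.
by rewrite polyXsubC_eq0.
Qed.

(** The eigenvalues of A^-1 B are real and positive because A^-1 B is self-adjoint
    for the scalar product of A. In dimension 2 this reduces to the signs of the
    trace, the determinant and the discriminant; the first and the last become
    sums of nonnegative terms after multiplication by positive factors. *)
Lemma pencil_roots (R : rcfType) (A B : 'M[R]_2) :
  0 < A 0 0 -> A 1 0 = A 0 1 -> 0 < \det A ->
  0 < B 0 0 -> B 1 0 = B 0 1 -> 0 < \det B ->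
  exists k1 k2, [/\ char_poly (invmx A *m B) = ('X - k1%:P) * ('X - k2%:P),
    0 < k1 & 0 < k2].
Proof.
move=> A00 As dA B00 Bs dB.
have uA : A \in unitmx by rewrite unitmxE unitfE gt_eqF.
set C := invmx A *m B.
have AC : A *m C = B by rewrite mulmxA mulmxV// mul1mx.
have eAC i j : B i j = A i 0 * C 0 j + A i 1 * C 1 j.
  by rewrite -AC mxE !big_ord_recl big_ord0 addr0 /= (_ : lift 0 0 = 1 :> 'I_2)//;
    exact/val_inj.
have dC : \det A * \det C = \det B by rewrite -det_mulmx AC.
have dC0 : 0 < \det C by rewrite -(pmulr_rgt0 _ dA) dC.
have trE : \tr C = C 0 0 + C 1 1.
  by rewrite /mxtrace !big_ord_recl big_ord0 addr0 /= (_ : lift 0 0 = 1 :> 'I_2)//;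
    exact/val_inj.
(* det A * A^-1 is the adjugate of A. *)
have T : \det A * \tr C =
    A 1 1 * B 0 0 - A 0 1 * B 0 1 - A 0 1 * B 0 1 + A 0 0 * B 1 1.
  by rewrite -{1}Bs trE det2 !eAC As; ring.
set p := \tr C in trE T *; set d := \det C in dC dC0 *.
have p0 : 0 < p.
  rewrite -(pmulr_rgt0 _ dA) T -(pmulr_rgt0 _ (mulr_gt0 A00 B00)).
  rewrite [X in 0 < X](_ : _ = B 0 0 ^+ 2 * \det A + A 0 0 ^+ 2 * \det B +
     (B 0 0 * A 0 1 - A 0 0 * B 0 1) ^+ 2); last by rewrite !det2 As Bs; ring.
  by rewrite ltr_wpDr ?sqr_ge0// addr_gt0// mulr_gt0// exprn_gt0.
have disc : 0 <= p ^+ 2 - 4 * d.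
  rewrite -(pmulr_rge0 _ (exprn_gt0 2 dA)) mulrBr.
  have -> : \det A ^+ 2 * p ^+ 2 = (\det A * p) ^+ 2 by ring.
  have -> : \det A ^+ 2 * (4 * d) = 4 * \det A * (\det A * d) by ring.
  rewrite T dC -(pmulr_rge0 _ (exprn_gt0 2 A00)).
  rewrite [X in 0 <= X](_ : _ = (A 0 0 * (A 0 0 * B 1 1 - A 1 1 * B 0 0) -
     2 * A 0 1 * (A 0 0 * B 0 1 - A 0 1 * B 0 0)) ^+ 2 +
     4 * \det A * (A 0 0 * B 0 1 - A 0 1 * B 0 0) ^+ 2); last first.
    by rewrite !det2 As Bs; ring.
  by rewrite addr_ge0 ?sqr_ge0// mulr_ge0 ?sqr_ge0// mulr_ge0// ltW.
set w := Num.sqrt (p ^+ 2 - 4 * d).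
have w2 : w ^+ 2 = p ^+ 2 - 4 * d by rewrite sqr_sqrtr.
have wp : w < p.
  by rewrite -(ltr_pXn2r (ltn0Sn 1)) ?nnegrE ?sqrtr_ge0 ?(ltW p0)// w2; lra.
exists ((p + w) / 2), ((p - w) / 2); split.
- apply: char_poly2; first by rewrite -/p; field.
  rewrite -/d (_ : d = (p ^+ 2 - w ^+ 2) / 4); first by field.
  by rewrite w2; field.
- have w0 : 0 <= w := sqrtr_ge0 _.
  by lra.
- by lra.
Qed.

(** * The radial profile of a face *)

Lemma diff_linear (R : numFieldType) (V W : normedModType R) (f : V -> W) x :
  linear f -> continuous f -> is_diff x f f.
Proof.
move=> flin fcont.
pose fM := GRing.isLinear.Build _ _ _ _ _ flin.
pose fL : {linear V -> W} := HB.pack f fM.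
have fE : f = fL by [].
apply: DiffDef; first by rewrite fE; exact: linear_differentiable.
by rewrite fE diff_lin.
Qed.
Lemma is_derive_pow (R : numFieldType) (V : normedModType R) (f : V -> R) n x v
    (df : R) :
  is_derive x v f df ->
  is_derive x v (fun y => f y ^+ n) (n%:R * f x ^+ n.-1 * df).
Proof.
move=> fd; elim: n => [|n IH]; first by rewrite !mul0r; exact: is_derive_cst.
rewrite (_ : (fun y => _) = f * (fun y => f y ^+ n)); last first.
  by apply/funext => y; rewrite exprS.
apply: is_derive_eq; rewrite /GRing.scale /=.
case: n {IH} => [|n] /=; first by rewrite expr0; ring.
by rewrite [in RHS]mulrSr exprS; ring.
Qed.

Lemma is_diff_fst (R : realType) (q : R * R) :
  is_diff q (fun q : R * R => q.1) (fun q => q.1).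
Proof. by apply: diff_linear => // x; exact: cvg_fst. Qed.
Lemma is_diff_snd (R : realType) (q : R * R) :
  is_diff q (fun q : R * R => q.2) (fun q => q.2).
Proof. by apply: diff_linear => // x; exact: cvg_snd. Qed.

Lemma powR_even_root (R : realType) (k : nat) (c : R) : 0 < c ->
  ((c `^ (- (2 * k.+1%:R)^-1)) ^+ 2) ^+ k.+1 * c = 1.
Proof.
move=> c0.
rewrite -exprM -powR_mulrn ?powR_ge0// -powRrM natrM mulNr mulVf.
  by rewrite powRN powRr1 ?ltW// mulVf// gt_eqF.
by rewrite mulf_neq0.
Qed.

Section RadialProfile.
Variables (R : realType) (k : nat) (eps : R).
Hypothesis eps_gt0 : 0 < eps.
Local Notation m := k.+1.

Definition sqn (q : R * R) : R := 1 + q.1 ^+ 2 + q.2 ^+ 2.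

(** The value of G at (1, u, v). *)
Definition gauge (q : R * R) : R :=
  1 + (q.1 ^+ 2) ^+ m + (q.2 ^+ 2) ^+ m + eps * sqn q ^+ m.

Definition radius (q : R * R) : R := gauge q `^ (- (2 * m%:R)^-1).

Lemma sqn_ge1 q : 1 <= sqn q.
Proof. by rewrite /sqn -addrA lerDl addr_ge0 ?sqr_ge0. Qed.

Lemma sqn_gt0 q : 0 < sqn q.
Proof. exact: lt_le_trans (sqn_ge1 q). Qed.

Lemma gauge_ge1 q : 1 <= gauge q.
Proof.
have s0 := sqn_gt0 q.
rewrite /gauge -!addrA lerDl.
by do 2 ?apply: addr_ge0; rewrite ?pmulr_rge0// exprn_ge0 ?sqr_ge0// ltW.
Qed.

Lemma gauge_gt0 q : 0 < gauge q.
Proof. exact: lt_le_trans (gauge_ge1 q). Qed.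

Lemma radius_gt0 q : 0 < radius q.
Proof. by rewrite powR_gt0 ?gauge_gt0. Qed.

Lemma radius_gauge q : (radius q ^+ 2) ^+ m * gauge q = 1.
Proof. exact/powR_even_root/gauge_gt0. Qed.

(** The smoothness of the patches is proved within the algebra generated by the
    coordinates and the radius. *)
Inductive elementary : (R * R -> R) -> Prop :=
| elementary_cst (c : R) : elementary (fun=> c)
| elementary_fst : elementary (fun q => q.1)
| elementary_snd : elementary (fun q => q.2)
| elementary_radius : elementary radius
| elementary_add f g : elementary f -> elementary g ->
    elementary (fun q => f q + g q)
| elementary_mul f g : elementary f -> elementary g ->
    elementary (fun q => f q * g q).

Lemma elementary_exp f n : elementary f -> elementary (fun q => f q ^+ n).
Proof.
move=> ef; elim: n => [|n IH].
  by rewrite (_ : (fun q => _) = fun=> 1)//; constructor.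
rewrite (_ : (fun q => _) = fun q => f q * f q ^+ n); first by constructor.
by apply/funext => q; rewrite exprS.
Qed.

Lemma elementary_sqn : elementary sqn.
Proof.
rewrite /sqn; do 2 ?[apply: elementary_add; last apply: elementary_exp];
by constructor.
Qed.

Lemma is_derive_fst v (q : R * R) : is_derive q v (fun q : R * R => q.1) v.1.
Proof.
have [df dE] := is_diff_fst q.
by apply: DeriveDef; [exact: diff_derivable|rewrite deriveE// dE].
Qed.

Lemma is_derive_snd v (q : R * R) : is_derive q v (fun q : R * R => q.2) v.2.
Proof.
have [df dE] := is_diff_snd q.
by apply: DeriveDef; [exact: diff_derivable|rewrite deriveE// dE].
Qed.

Lemma differentiable_gauge q : differentiable gauge q.
Proof.
have [d1 _] := is_diff_fst q; have [d2 _] := is_diff_snd q.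
have dD (f g : R * R -> R) : differentiable f q -> differentiable g q ->
    differentiable (fun x => f x + g x) q by exact: differentiableD.
have dM (f g : R * R -> R) : differentiable f q -> differentiable g q ->
    differentiable (fun x => f x * g x) q by exact: differentiableM.
have dC (c : R) : differentiable (fun=> c) q by exact: differentiable_cst.
have dX (f : R * R -> R) n : differentiable f q ->
    differentiable (fun x => f x ^+ n) q.
  move=> df; elim: n => [|n IH]; first exact: dC.
  rewrite (_ : (fun x => _) = fun x => f x * f x ^+ n); first exact: dM.
  by apply/funext => x; rewrite exprS.
have ds : differentiable sqn q.
  by apply: (dD) (dX _ _ d2); apply: (dD) (dX _ _ d1).
apply: (dD) ; last exact: (dM) (dX _ _ ds).
apply: (dD) ; last exact/(dX)/(dX).
by apply: (dD) => //; exact/(dX)/(dX).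
Qed.

(** With n = |x| ^ 2 this is the partial derivative of G, divided by 2m, in the
    direction of a coordinate of value t. *)
Definition slope (n t : R) : R := t * ((t ^+ 2) ^+ k + eps * n ^+ k).

Definition dslope (q v : R * R) : R :=
  slope (sqn q) q.1 * v.1 + slope (sqn q) q.2 * v.2.

Lemma is_derive_gauge v q : is_derive q v gauge (2 * m%:R * dslope q v).
Proof.
have d1 := is_derive_fst v q; have d2 := is_derive_snd v q.
have ds : is_derive q v sqn (2 * (q.1 * v.1 + q.2 * v.2)).
  apply: is_derive_eq.
  by rewrite /= /GRing.scale /=; ring.
have d1m := is_derive_pow m (is_derive_pow 2 d1).
have d2m := is_derive_pow m (is_derive_pow 2 d2).
have dsm := is_derive_pow m ds.
have /is_derive_eq :=
  is_deriveD (is_deriveD (is_deriveD (is_derive_cst (1 : R) q v) d1m) d2m)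
  (is_deriveZ eps dsm).
by apply; rewrite /GRing.scale /dslope /slope /=; ring.
Qed.

Lemma differentiable_radius q : differentiable radius q.
Proof.
have dp : differentiable (@powR R ^~ (- (2 * m%:R)^-1)) (gauge q).
  by apply/derivable1_diffP;
    have [] := is_derive1_powR (- (2 * m%:R)^-1) (gauge_gt0 q).
exact: (differentiable_comp (differentiable_gauge q) dp).
Qed.

(** The radius is gauge ^ (-1 / 2m), so that its derivative is the one of the gauge
    times - radius / (2m * gauge), and 1 / gauge is a power of the radius. *)
Lemma is_derive_radius v q :
  is_derive q v radius (- (radius q * (radius q ^+ 2) ^+ m * dslope q v)).
Proof.
have gq := gauge_gt0 q.
have [dp dpE] := is_derive1_powR (- (2 * m%:R)^-1) gq.
move/derivable1_diffP in dp.
apply: DeriveDef; first exact/diff_derivable/differentiable_radius.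
rewrite deriveE; last exact: differentiable_radius.
rewrite (diff_comp (differentiable_gauge q) dp) /= diff1E// derive1E dpE.
rewrite -deriveE; last exact: differentiable_gauge.
rewrite (derive_val (is_derive := is_derive_gauge v q)) /GRing.scale /=.
rewrite powRB ?(gt_eqF gq) ?implybT// powRr1 ?ltW// -/(radius q).
have -> : (gauge q)^-1 = (radius q ^+ 2) ^+ m.
  apply: (mulIf (lt0r_neq0 gq)).
  by rewrite radius_gauge mulVf// gt_eqF.
have : m%:R != 0 :> R by rewrite pnatr_eq0.
by move: (m%:R) => M M0; field.
Qed.

Lemma elementary_slope t : elementary t ->
  elementary (fun q => slope (sqn q) (t q)).
Proof.
move=> et; apply: elementary_mul => //; apply: elementary_add.
  by do 2 apply: elementary_exp.
apply: (@elementary_mul (fun=> eps) (fun q => sqn q ^+ k)).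
  exact: elementary_cst.
exact/elementary_exp/elementary_sqn.
Qed.

Lemma elementary_dslope v : elementary (dslope ^~ v).
Proof.
rewrite /dslope; apply: elementary_add.
  apply: (@elementary_mul _ (fun=> v.1)); last exact: elementary_cst.
  by apply: elementary_slope; constructor.
apply: (@elementary_mul _ (fun=> v.2)); last exact: elementary_cst.
by apply: elementary_slope; constructor.
Qed.

(** The algebra is stable under all directional derivatives because the derivative
    of the radius is a polynomial in the radius and the coordinates. *)
Lemma elementary_derive f : elementary f ->
  (forall q, differentiable f q) /\ (forall v, elementary ('D_v f)).
Proof.
elim=> {f} [c||||f g _ [df ef] _ [dg eg]|f g ef0 [df ef] eg0 [dg eg]].
- split=> [q|v]; first exact: differentiable_cst.
  rewrite (_ : 'D_v _ = fun=> 0); first by constructor.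
  by apply/funext => q; exact: derive_cst.
- split=> [q|v]; first by have [] := is_diff_fst q.
  rewrite (_ : 'D_v _ = fun=> v.1); first by constructor.
  by apply/funext => q; rewrite (derive_val (is_derive := is_derive_fst v q)).
- split=> [q|v]; first by have [] := is_diff_snd q.
  rewrite (_ : 'D_v _ = fun=> v.2); first by constructor.
  by apply/funext => q; rewrite (derive_val (is_derive := is_derive_snd v q)).
- split=> [q|v]; first exact: differentiable_radius.
  rewrite (_ : 'D_v _ =
      fun q => -1 * ((radius q * (radius q ^+ 2) ^+ m) * dslope q v)).
    apply: (@elementary_mul (fun=> -1)); first by constructor.
    apply: elementary_mul (elementary_dslope v).
    apply: elementary_mul; first by constructor.
    by do 2 apply: elementary_exp; constructor.
  apply/funext => q; rewrite (derive_val (is_derive := is_derive_radius v q)).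
  by rewrite mulN1r.
- split=> [q|v]; first exact: differentiableD.
  rewrite (_ : 'D_v _ = fun q => 'D_v f q + 'D_v g q); first by constructor.
  by apply/funext => q; rewrite deriveD//; exact: diff_derivable.
- split=> [q|v]; first exact: differentiableM.
  rewrite (_ : 'D_v _ = fun q => f q * 'D_v g q + g q * 'D_v f q).
    by apply: elementary_add; apply: elementary_mul.
  by apply/funext => q; rewrite deriveM//; exact: diff_derivable.
Qed.

Definition elementary_map n (X : R * R -> 'rV[R]_n) :=
  forall j, elementary (fun q => X q 0 j).

Lemma elementary_map_differentiable n (X : R * R -> 'rV[R]_n) q :
  elementary_map X -> differentiable X q.
Proof.
move=> eX.
have -> : X = \sum_(j < n) (fun q => X q 0 j *: delta_mx 0 j).
  by apply/funext => x; rewrite {1}(row_sum_delta (X x)) fct_sumE.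
apply: differentiable_sum => j; apply: differentiableZl.
by have [+ _] := elementary_derive (eX j); exact.
Qed.

Lemma elementary_map_derive n (X : R * R -> 'rV[R]_n) v :
  elementary_map X -> elementary_map ('D_v X).
Proof.
move=> eX j; have [_ /(_ v)] := elementary_derive (eX j).
congr elementary; apply/funext => q.
rewrite derive_mx ?mxE//.
exact/diff_derivable/elementary_map_differentiable.
Qed.

Lemma elementary_map_smooth n (X : R * R -> 'rV[R]_n) :
  elementary_map X -> smooth_on setT X.
Proof.
move=> eX l; elim: l X eX => [|l IH] X eX /=.
  by move=> q _; exact/differentiable_continuous/elementary_map_differentiable.
split=> [q _|v]; first exact: elementary_map_differentiable.
exact/IH/elementary_map_derive.
Qed.

End RadialProfile.

(** * Integrals over squares *)

Lemma measurable_sqn (R : realType) :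
  measurable_fun setT (@sqn R : measurableTypeR R * measurableTypeR R -> R).
Proof.
have m1 : measurable_fun setT
    (fst : measurableTypeR R * measurableTypeR R -> R) by exact: measurable_fst.
have m2 : measurable_fun setT
    (snd : measurableTypeR R * measurableTypeR R -> R) by exact: measurable_snd.
by do 2 ?apply: measurable_funD => //; exact: measurable_funX.
Qed.

Lemma integral_quadratic (R : realType) (c d : R) :
  (\int[lebesgue_measure]_(x in `[(-1)%R, 1%R]) (c + d * x ^+ 2)%:E
   = (2 * c + 2 / 3 * d)%:E)%E.
Proof.
pose F (x : R) := c * x + d / 3 * x ^+ 3.
have dF (x : R) : is_derive x 1 F (c + d * x ^+ 2).
  have /is_derive_eq := is_deriveD (is_deriveZ c (is_derive_id x (1 : R)))
     (is_deriveZ (d / 3) (is_deriveX 3 (is_derive_id x (1 : R)))).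
  by apply; rewrite /GRing.scale /=; field.
have cF : continuous F.
  by move=> x; apply/differentiable_continuous/derivable1_diffP; have [] := dF x.
rewrite (@continuous_FTC2 _ (fun x => c + d * x ^+ 2) F).
- by rewrite -EFinB /F; congr EFin; field.
- lra.
- apply: continuous_subspaceT => x; apply: cvgD; first exact: cvg_cst.
  by apply: cvgM; [exact: cvg_cst|exact: exprn_continuous].
- split=> [x _||]; first by have [] := dF x.
  + exact/cvg_at_right_filter/cF.
  + exact/cvg_at_left_filter/cF.
- by move=> x _; rewrite derive1E; have [_ ->] := dF x.
Qed.

Section SquareIntegrals.
Variable R : realType.
Local Notation mu := (@lebesgue_measure R).
Local Notation plane := (measurableTypeR R * measurableTypeR R)%type.

Lemma measurable_square (I J : interval R) :
  measurable ([set` I] `*` [set` J] : set plane).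
Proof. by apply: measurableX; exact: measurable_itv. Qed.

Lemma measure_square (a : R) : 0 <= a ->
  (mu \x mu)%E (`[- a, a] `*` `[- a, a] : set plane) = ((2 * a) ^+ 2)%:E.
Proof.
move=> a0; have E : mu (`[- a, a]%classic : set R) = (2 * a)%:E.
  rewrite lebesgue_measure_itv /= lte_fin.
  case: ltP => [_|aa]; first by rewrite -EFinB; congr EFin; ring.
  by rewrite (_ : a = 0) ?mulr0//; lra.
apply: etrans (product_measure1E _ _ _ _) _; try exact: measurable_itv.
by apply: etrans (congr2 mule E E) _; rewrite -EFinM expr2.
Qed.

(** The moment density of a face of the cube. *)
Lemma integral_sqn :
  (\int[mu \x mu]_(q in (`[(-1)%R, 1%R] `*` `[(-1)%R, 1%R] : set plane)) (sqn q)%:E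
   = (20 / 3)%:E)%E.
Proof.
set I : set R := `[(-1)%R, 1%R]%classic.
have mI : measurable (I : set (measurableTypeR R)) by exact: measurable_itv.
have msqn : measurable_fun setT (EFin \o (@sqn R : plane -> R)).
  by apply/measurable_EFinP; exact: measurable_sqn.
rewrite integral_mkcond fubini_tonelli1; last 2 first.
- apply/(measurable_restrictT _ _).1; first exact: measurableX.
  exact: measurable_funS msqn.
- move=> q; apply: erestrict_ge0 => {}q _.
  by rewrite lee_fin ltW// sqn_gt0.
rewrite /fubini_F.
transitivity (\int[mu]_(x in I) (8 / 3 + 2 * x ^+ 2)%:E)%E; last first.
  by rewrite integral_quadratic; congr EFin; field.
rewrite [RHS]integral_mkcond; apply: eq_integral => x _.
rewrite [RHS]patchE; case: ifPn => xI.
  transitivity (\int[mu]_(y in I) ((1 + x ^+ 2) + 1 * y ^+ 2)%:E)%E; last first.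
    by rewrite integral_quadratic; congr EFin; field.
  rewrite [RHS]integral_mkcond; apply: eq_integral => y _.
  by rewrite !patchE in_setX xI /=; case: ifP => // _; rewrite /sqn mul1r.
by apply: integral0_eq => y _; rewrite patchE in_setX (negbTE xI).
Qed.
End SquareIntegrals.

(** * The surface and its patches *)

(** In 'I_3 the subtraction is modulo 3, and -1 is the index 2. *)
Lemma sum_shift (R : nmodType) (F : 'I_3 -> R) (i : 'I_3) :
  \sum_(j < 3) F (j - i) = F 0 + F 1 + F (-1).
Proof.
rewrite (reindex_inj (addIr i)) /=; under eq_bigr do rewrite addrK.
rewrite !big_ord_recl big_ord0 addr0 addrA.
by congr (F _ + F _ + F _); exact/val_inj.
Qed.

Lemma dotvC (R : realType) n (x y : 'rV[R]_n) : dotv x y = dotv y x.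
Proof. by apply: eq_bigr => j _; rewrite mulrC. Qed.

Lemma dotvDl (R : realType) n (x y z : 'rV[R]_n) :
  dotv (x + y) z = dotv x z + dotv y z.
Proof. by rewrite -big_split; apply: eq_bigr => j _; rewrite mxE mulrDl. Qed.

Lemma dotvZl (R : realType) n (c : R) (x z : 'rV[R]_n) :
  dotv (c *: x) z = c * dotv x z.
Proof. by rewrite /dotv mulr_sumr; apply: eq_bigr => j _; rewrite mxE mulrA. Qed.

Lemma dotv_ge0 (R : realType) n (x : 'rV[R]_n) : 0 <= dotv x x.
Proof. by apply: sumr_ge0 => j _; rewrite -expr2 sqr_ge0. Qed.

Lemma dotv_eq0 (R : realType) n (x : 'rV[R]_n) : (dotv x x == 0) = (x == 0).
Proof.
apply/eqP/eqP => [x0|->]; last by apply: big1 => j _; rewrite mxE mul0r.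
apply/rowP => j; rewrite mxE; apply/eqP; rewrite -sqrf_eq0 expr2; apply/eqP.
have /psumr_eq0P := x0; apply=> //= l _; by rewrite -expr2 sqr_ge0.
Qed.

Lemma dotv_gt0 (R : realType) n (x : 'rV[R]_n) : (0 < dotv x x) = (x != 0).
Proof. by rewrite lt0r dotv_ge0 dotv_eq0 andbT. Qed.

Lemma row_neq0_coord (R : nmodType) n (x : 'rV[R]_n) :
  x != 0 -> exists i, x 0 i != 0.
Proof.
move=> x0; apply/existsP; rewrite -[X in is_true X]negbK; apply: contra x0.
move=> /existsPn x0; apply/eqP/rowP => j; rewrite mxE.
by apply/eqP; rewrite -[_ == _]negbK.
Qed.

Section RoundedCube.
Variables (R : realType) (k : nat) (eps : R).
Hypothesis eps_gt0 : 0 < eps.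
Local Notation m := k.+1.
Local Notation gauge := (@gauge R k eps).
Local Notation radius := (@radius R k eps).
Local Notation slope := (@slope R k eps).
Local Notation dslope := (@dslope R k eps).
Implicit Types (q v w : R * R) (s : R) (x y : 'rV[R]_3) (i j : 'I_3).

Definition cube_gauge (x : 'rV[R]_3) : R :=
  \sum_(j < 3) (x 0 j ^+ 2) ^+ m + eps * dotv x x ^+ m.

Definition rounded_cube : set 'rV[R]_3 := [set x | cube_gauge x = 1].

(** The coordinates of (s, u, v). *)
Definition coord s q (l : 'I_3) : R :=
  if l == 0 then s else if l == 1 then q.1 else q.2.

(** The coordinate i is the one that is constant on the face. *)
Definition face (i : 'I_3) s q : 'rV[R]_3 := \row_j coord s q (j - i).

Definition patch (i : 'I_3) s q : 'rV[R]_3 := radius q *: face i s q.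

Lemma sum_coord (F : R -> R) (i : 'I_3) s q :
  \sum_(j < 3) F (coord s q (j - i)) = F s + F q.1 + F q.2.
Proof. exact: (sum_shift (fun l => F (coord s q l))). Qed.

Lemma dotv_face i s s' q q' :
  dotv (face i s q) (face i s' q') = s * s' + q.1 * q'.1 + q.2 * q'.2.
Proof.
rewrite /dotv; under eq_bigr do rewrite !mxE.
exact: (sum_shift (fun l => coord s q l * coord s' q' l)).
Qed.

Lemma cube_gaugeZ c x : cube_gauge (c *: x) = (c ^+ 2) ^+ m * cube_gauge x.
Proof.
rewrite /cube_gauge mulrDr mulr_sumr; congr (_ + _).
  by apply: eq_bigr => j _; rewrite mxE [(c * _) ^+ 2]exprMn exprMn.
by rewrite dotvZl [dotv x _]dotvC dotvZl mulrA -expr2 exprMn; ring.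
Qed.

Lemma cube_gauge_face i s q : s ^+ 2 = 1 -> cube_gauge (face i s q) = gauge q.
Proof.
move=> s1; rewrite /cube_gauge dotv_face -!expr2 s1; congr (_ + _).
under eq_bigr do rewrite mxE.
by rewrite (sum_coord (fun t => (t ^+ 2) ^+ m)) s1 expr1n.
Qed.

Lemma patch_surface i s q : s ^+ 2 = 1 -> rounded_cube (patch i s q).
Proof.
by move=> s1; rewrite /rounded_cube /= cube_gaugeZ cube_gauge_face// radius_gauge.
Qed.

Lemma elementary_patch i s : elementary_map k eps (patch i s).
Proof.
move=> j.
rewrite (_ : (fun q => _) = fun q => radius q * coord s q (j - i)); last first.
  by apply/funext => q; rewrite !mxE.
apply: elementary_mul; first by constructor.
by rewrite /coord; case: (j - i == 0); [|case: (j - i == 1)]; constructor.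
Qed.

Lemma derive_patch i s v q :
  'D_v (patch i s) q =
  (- (radius q * (radius q ^+ 2) ^+ m * dslope q v)) *: face i s q +
  radius q *: face i 0 v.
Proof.
have d := elementary_map_differentiable eps_gt0 q (elementary_patch i s).
rewrite derive_mx; last exact: diff_derivable.
apply/rowP => j; rewrite !mxE.
rewrite (_ : (fun q => _) = fun q => radius q * coord s q (j - i)); last first.
  by apply/funext => x; rewrite !mxE.
have dr := is_derive_radius k eps_gt0 v q.
have dc : is_derive q v (fun q => coord s q (j - i)) (coord 0 v (j - i)).
  rewrite /coord; case: (j - i == 0); first exact: is_derive_cst.
  by case: (j - i == 1); [exact: is_derive_fst|exact: is_derive_snd].
rewrite (derive_val (is_derive := is_deriveM dr dc)).
by rewrite /GRing.scale /=; ring.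
Qed.

(** The squared norm of the gradient of G, divided by 2m, at (s, u, v). *)
Definition normal_sq q : R :=
  (1 + eps * sqn q ^+ k) ^+ 2 + slope (sqn q) q.1 ^+ 2 + slope (sqn q) q.2 ^+ 2.

Lemma basis2_0 : basis2 R 0 = (1, 0). Proof. by []. Qed.

Lemma basis2_1 : basis2 R 1 = (0, 1). Proof. by []. Qed.

Lemma first_formE (X : R * R -> 'rV[R]_3) q a b :
  first_form X q a b = dotv ('D_(basis2 R a) X q) ('D_(basis2 R b) X q).
Proof. by rewrite mxE; apply: eq_bigr => j _; rewrite !mxE. Qed.

Lemma gauge_slope q : gauge q =
  1 + eps * sqn q ^+ k + q.1 * slope (sqn q) q.1 + q.2 * slope (sqn q) q.2.
Proof. by rewrite /gauge /slope !exprS /sqn; ring. Qed.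

Lemma dotv_derive_patch i s v w q : s ^+ 2 = 1 ->
  dotv ('D_v (patch i s) q) ('D_w (patch i s) q) =
  radius q ^+ 2 *
    ((radius q ^+ 2) ^+ m ^+ 2 * dslope q v * dslope q w * sqn q
     - (radius q ^+ 2) ^+ m * dslope q v * (q.1 * w.1 + q.2 * w.2)
     - (radius q ^+ 2) ^+ m * dslope q w * (q.1 * v.1 + q.2 * v.2)
     + (v.1 * w.1 + v.2 * w.2)).
Proof.
move=> s1; rewrite !derive_patch !(dotvDl, dotvZl).
rewrite ![dotv _ (_ + _)]dotvC !(dotvDl, dotvZl) !dotv_face -[s * s]expr2 s1 /sqn.
by ring.
Qed.

(** The left side is |X_u x X_v| ^ 2, and X_u x X_v is the multiple of the gradient
    of G, divided by 2m, at (s, u, v) by a power of the radius. *)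
Lemma det_first_form i s q : s ^+ 2 = 1 ->
  \det (first_form (patch i s) q) =
  (radius q ^+ 2 * (radius q ^+ 2) ^+ m) ^+ 2 * normal_sq q.
Proof.
move=> s1.
have fE a b : first_form (patch i s) q a b = _ :=
  etrans (first_formE _ _ _ _) (dotv_derive_patch _ _ _ _ s1).
rewrite det2.
apply: etrans (congr2 (fun a b => a - b) (congr2 *%R (fE 0 0) (fE 1 1))
  (congr2 *%R (fE 0 1) (fE 1 0))) _.
rewrite basis2_0 basis2_1 /dslope /=.
rewrite !mulr1 !mulr0 !addr0 !add0r.
have := radius_gauge k eps_gt0 q.
rewrite gauge_slope /normal_sq.
move: (slope _ q.1) (slope _ q.2) (radius q ^+ 2) => a b r.
move: (_ ^+ m) (eps * _) => L c Lg.
have -> : 1 + c = 1 + c + q.1 * a + q.2 * b - (q.1 * a + q.2 * b) by ring.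
set g := 1 + c + _ + _ in Lg *.
have -> : (r * L) ^+ 2 * ((g - (q.1 * a + q.2 * b)) ^+ 2 + a ^+ 2 + b ^+ 2) =
  r ^+ 2 * ((L * g - L * (q.1 * a + q.2 * b)) ^+ 2 + (L * a) ^+ 2 + (L * b) ^+ 2).
  by ring.
by rewrite Lg /sqn; ring.
Qed.

Lemma normal_sq_ge1 q : 1 <= normal_sq q.
Proof.
have c0 : 0 <= eps * sqn q ^+ k by rewrite mulr_ge0 ?ltW// exprn_gt0// sqn_gt0.
rewrite /normal_sq -addrA ler_wpDr ?addr_ge0 ?sqr_ge0//.
by rewrite -[leLHS](expr1n _ 2) ler_sqr ?nnegrE ?addr_ge0// lerDl.
Qed.

Lemma normal_sq_gt0 q : 0 < normal_sq q.
Proof. exact: lt_le_trans (normal_sq_ge1 q). Qed.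

Lemma det_first_form_gt0 i s q : s ^+ 2 = 1 ->
  0 < \det (first_form (patch i s) q).
Proof.
move=> s1; rewrite det_first_form// mulr_gt0 ?normal_sq_gt0//.
by rewrite exprn_gt0// mulr_gt0// !exprn_gt0// radius_gt0.
Qed.

Lemma area_density_patch i s q : s ^+ 2 = 1 ->
  area_density (patch i s) q =
  radius q ^+ 2 * (radius q ^+ 2) ^+ m * Num.sqrt (normal_sq q).
Proof.
move=> s1; rewrite /area_density det_first_form// sqrtrM ?sqr_ge0//.
rewrite sqrtr_sqr ger0_norm// mulr_ge0// !exprn_ge0//; exact/ltW/radius_gt0.
Qed.

(** A right inverse of the Jacobian J is J^T (J J^T)^-1. *)
Lemma row_free_jac i s q : s ^+ 2 = 1 -> row_free (jac (patch i s) q).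
Proof.
move=> s1; apply/row_freeP.
exists ((jac (patch i s) q)^T *m invmx (first_form (patch i s) q)).
rewrite mulmxA mulmxV// unitmxE unitfE gt_eqF//; exact: det_first_form_gt0.
Qed.

(** * The surface is closed and star-shaped *)

(** The central projection to the face, inverse of the patch. *)
Definition proj (i : 'I_3) s (x : 'rV[R]_3) : R * R :=
  (x 0 (i + 1) / (s * x 0 i), x 0 (i - 1) / (s * x 0 i)).

Lemma even_root_unique (a b c : R) : 0 < a -> 0 < b ->
  (a ^+ 2) ^+ m * c = 1 -> (b ^+ 2) ^+ m * c = 1 -> a = b.
Proof.
move=> a0 b0 ac bc.
have c0 : c != 0.
  by apply/eqP => c0; move: ac; rewrite c0 mulr0 => /eqP; rewrite eq_sym oner_eq0.
apply/eqP; rewrite -(@eqrXn2 _ 2%N) ?ltW// -(@eqrXn2 _ m) ?exprn_ge0 ?ltW//.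
by apply/eqP/(mulIf c0); rewrite ac bc.
Qed.

Lemma proj_patch i s q : s ^+ 2 = 1 -> proj i s (patch i s q) = q.
Proof.
move=> s1; have r0 : radius q != 0 by rewrite gt_eqF// radius_gt0.
rewrite /proj !mxE subrr addrAC subrr add0r addrAC subrr add0r /coord /=.
rewrite (_ : s * (radius q * s) = radius q); last by rewrite mulrCA -expr2 s1 mulr1.
by rewrite ![radius q * _]mulrC !mulfK// -surjective_pairing.
Qed.

(** The point x is c * (s, u, v) with c = s * x_i > 0; since G x = 1 and G is
    homogeneous of degree 2m, c ^ 2m = 1 / G (s, u, v), whence c is the radius. *)
Lemma patch_proj i s x : s ^+ 2 = 1 -> rounded_cube x -> 0 < s * x 0 i ->
  patch i s (proj i s x) = x.
Proof.
move=> s1 Sx c0; have cn0 : s * x 0 i != 0 by rewrite gt_eqF.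
have xE : s * x 0 i *: face i s (proj i s x) = x.
  apply/rowP => j; rewrite !mxE -{2}(subrK i j); move: (j - i) => l.
  rewrite /coord; case: ifPn => [/eqP->|l0].
    by rewrite add0r mulrAC -expr2 s1 mul1r.
  case: ifPn => [/eqP->|l1]; first by rewrite /= mulrC divfK// addrC.
  rewrite /= mulrC divfK// [l + i]addrC; congr (x 0 (i + _)).
  by apply/val_inj; move: l0 l1; case: l => -[|[|[|]]].
rewrite -[RHS]xE /patch; congr (_ *: _).
apply: (@even_root_unique _ _ (gauge (proj i s x))) => //.
- exact: radius_gt0.
- exact: radius_gauge.
by rewrite -(cube_gauge_face i _ s1) -cube_gaugeZ xE.
Qed.

Lemma open_proj_preimage i s (W : set (R * R)) : open W ->
  open [set x : 'rV[R]_3 | 0 < s * x 0 i /\ W (proj i s x)].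
Proof.
move=> Wo; rewrite openE => x [c0 Wx].
have cc j : {for x, continuous (fun y : 'rV[R]_3 => y 0 j)}.
  exact: coord_continuous.
have cd : {for x, continuous (fun y : 'rV[R]_3 => s * y 0 i)}.
  by apply: continuousM; [exact: cst_continuous|exact: cc].
have cp : {for x, continuous (proj i s)}.
  have cq j : {for x, continuous (fun y : 'rV[R]_3 => y 0 j / (s * y 0 i))}.
    by apply: continuousM => //; apply: continuousV => //; rewrite gt_eqF.
  exact: (cvg_pair (cq (i + 1)) (cq (i - 1))).
apply: filterI.
  exact: (cvgr_gt _ cd _ c0).
exact: (cp W (open_nbhs_nbhs (conj Wo Wx))).
Qed.

Lemma local_param_patch i s : s ^+ 2 = 1 ->
  local_param rounded_cube setT (patch i s).
Proof.
move=> s1; split.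
- exact: openT.
- exact/(elementary_map_smooth eps_gt0)/elementary_patch.
- by move=> q _; exact: row_free_jac.
- by move=> q q' _ _ E; rewrite -(proj_patch i q s1) E proj_patch.
move=> W Wo _; exists [set x : 'rV[R]_3 | 0 < s * x 0 i /\ W (proj i s x)].
  exact: open_proj_preimage.
apply/seteqP; split=> [x [q Wq <-]|x [Sx [c0 Wx]]]; last first.
  by exists (proj i s x) => //; exact: patch_proj.
split; first exact: patch_surface.
rewrite /= proj_patch//; split=> //.
by rewrite !mxE subrr /coord eqxx mulrCA -expr2 s1 mulr1 radius_gt0.
Qed.

Lemma cube_gauge_ge_coord x j : (x 0 j ^+ 2) ^+ m <= cube_gauge x.
Proof.
rewrite /cube_gauge (bigD1 j)//= -addrA lerDl addr_ge0//.
  by apply: sumr_ge0 => l _; rewrite exprn_ge0// sqr_ge0.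
by rewrite mulr_ge0 ?exprn_ge0 ?dotv_ge0// ltW.
Qed.

Lemma rounded_cube_coord x j : rounded_cube x -> x 0 j ^+ 2 <= 1.
Proof.
move=> Sx; rewrite -(expr_le1 (ltn0Sn k)) ?sqr_ge0//.
by rewrite -Sx; exact: cube_gauge_ge_coord.
Qed.

Lemma cube_gauge_gt0 x : x != 0 -> 0 < cube_gauge x.
Proof.
move=> x0; rewrite /cube_gauge ltr_wpDl//.
  by apply: sumr_ge0 => j _; rewrite exprn_ge0// sqr_ge0.
by rewrite mulr_gt0// exprn_gt0// dotv_gt0.
Qed.

Lemma rounded_cube_neq0 x : rounded_cube x -> x != 0.
Proof.
move=> Sx; apply/eqP => x0; move: Sx; rewrite /rounded_cube /= x0.
rewrite -(scale0r 0) cube_gaugeZ expr0n/= expr0n mul0r => /eqP.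
by rewrite eq_sym oner_eq0.
Qed.

Lemma cube_gauge_continuous : continuous cube_gauge.
Proof.
move=> x.
have cX (f : 'rV[R]_3 -> R) n : {for x, continuous f} ->
    {for x, continuous (fun y => f y ^+ n)}.
  move=> fc; exact: (continuous_comp fc (@exprn_continuous _ n _)).
have cs (f : 'I_3 -> 'rV[R]_3 -> R) : (forall j, {for x, continuous (f j)}) ->
    {for x, continuous (fun y => \sum_(j < 3) f j y)}.
  move=> fc; rewrite (_ : (fun y => _) = \sum_(j < 3) f j); last by rewrite fct_sumE.
   elim/big_ind: _ => [|g h gc hc|j _].
  - exact: cst_continuous.
  - exact: continuousD.
  - exact: fc.
have cc j : {for x, continuous (fun y : 'rV[R]_3 => y 0 j)}.
  exact: coord_continuous.
have c1 : {for x, continuous (fun y => \sum_(j < 3) (y 0 j ^+ 2) ^+ m)}.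
  by apply: (cs) => j; exact/(cX)/(cX).
have c2 : {for x, continuous (fun y => dotv y y)}.
  by apply: (cs) => j; exact: continuousM.
have c3 : {for x, continuous (fun y => eps * dotv y y ^+ m)}.
  by apply: continuousM; [exact: cst_continuous|exact: cX].
exact: (continuousD c1 c3).
Qed.

Lemma compact_rounded_cube : compact rounded_cube.
Proof.
apply: bounded_closed_compact; last first.
  rewrite (_ : rounded_cube = cube_gauge @^-1` [set 1])//.
  by apply: preimage_closed => [x _|]; [exact: cube_gauge_continuous|exact: closed_eq].
exists 1; split=> // M M1 x Sx; apply: le_trans (ltW M1).
rewrite /Num.Def.normr /= mx_normrE; apply: bigmax_le => //= -[l j] _ /=.
rewrite (ord1 l) -(expr_le1 (ltn0Sn 1))// real_normK ?num_real//.
exact: rounded_cube_coord.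
Qed.

Lemma closed_rounded_cube : closed_surface rounded_cube.
Proof.
split; last exact: compact_rounded_cube.
move=> x Sx; have [i xi0] := row_neq0_coord (rounded_cube_neq0 Sx).
have s1 : Num.sg (x 0 i) ^+ 2 = 1 by rewrite sqr_sg xi0.
exists setT, (patch i (Num.sg (x 0 i))); split; first exact: local_param_patch.
exists (proj i (Num.sg (x 0 i)) x) => //; apply: patch_proj => //.
by rewrite -normrEsg normr_gt0.
Qed.

Lemma star_shaped_rounded_cube : star_shaped rounded_cube.
Proof.
exists 0, 1, (fun x => cube_gauge x `^ (- (2 * m%:R)^-1)).
have sphereE (th : 'rV[R]_3) : eucl_sphere 0 (1 : R) th -> dotv th th = 1.
  rewrite /eucl_sphere /= /eucl_dist subr0 => E.
  by rewrite -[LHS]sqr_sqrtr ?dotv_ge0// E expr1n.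
have sphere0 (th : 'rV[R]_3) : eucl_sphere 0 (1 : R) th -> th != 0.
  by move/sphereE => E; rewrite -dotv_gt0 E.
split=> // [th /sphere0/cube_gauge_gt0|]; first exact: powR_gt0.
apply/seteqP; split=> [x Sx|_ [th /sphere0/cube_gauge_gt0 g0 <-]]; last first.
  by rewrite /rounded_cube /= add0r subr0 cube_gaugeZ powR_even_root.
have d0 : 0 < dotv x x by rewrite dotv_gt0; exact: rounded_cube_neq0.
set N := Num.sqrt (dotv x x).
have N0 : 0 < N by rewrite sqrtr_gt0.
have N2 : N ^+ 2 = dotv x x by rewrite sqr_sqrtr// ltW.
have nS : eucl_sphere 0 (1 : R) (N^-1 *: x).
  rewrite /eucl_sphere /= /eucl_dist subr0 dotvZl dotvC dotvZl -N2.
  by rewrite expr2 mulKf ?gt_eqF// mulVf ?gt_eqF// sqrtr1.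
exists (N^-1 *: x) => //; rewrite add0r subr0.
suff -> : cube_gauge (N^-1 *: x) `^ (- (2 * m%:R)^-1) = N.
  by rewrite scalerA mulfV ?gt_eqF// scale1r.
have g0 := cube_gauge_gt0 (sphere0 _ nS).
apply: (@even_root_unique _ _ (cube_gauge (N^-1 *: x))) => //.
- exact: powR_gt0.
- exact: powR_even_root.
by rewrite -cube_gaugeZ scalerA mulfV ?gt_eqF// scale1r.
Qed.

(** * Strict convexity *)

(** The gradient of G divided by 2m. *)
Definition normal_field x : 'rV[R]_3 := \row_j slope (dotv x x) (x 0 j).

Lemma slopeZ r n t : slope (r ^+ 2 * n) (r * t) = r * (r ^+ 2) ^+ k * slope n t.
Proof. by rewrite /slope !exprMn; ring. Qed.

Lemma normal_fieldZ r x :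
  normal_field (r *: x) = (r * (r ^+ 2) ^+ k) *: normal_field x.
Proof.
apply/rowP => j; rewrite !mxE -slopeZ; congr slope.
by rewrite dotvZl dotvC dotvZl mulrA -expr2.
Qed.

Lemma slope_sign n s : s ^+ 2 = 1 -> slope n s = s * (1 + eps * n ^+ k).
Proof. by move=> s1; rewrite /slope s1 expr1n. Qed.

(** Euler's identity for the homogeneous function G. *)
Lemma dotv_face_normal i s q : s ^+ 2 = 1 ->
  dotv (face i s q) (normal_field (face i s q)) = gauge q.
Proof.
move=> s1; rewrite {1}/dotv; under eq_bigr do rewrite !mxE.
rewrite dotv_face -!expr2 s1.
rewrite (sum_coord (fun t => t * slope (sqn q) t)) slope_sign// gauge_slope.
by rewrite mulrA -expr2 s1 mul1r.
Qed.

Lemma dotv_face0_normal i s q v : s ^+ 2 = 1 ->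
  dotv (face i 0 v) (normal_field (face i s q)) = dslope q v.
Proof.
move=> s1; rewrite {1}/dotv; under eq_bigr do rewrite !mxE.
rewrite dotv_face -!expr2 s1.
rewrite (sum_shift (fun l => coord 0 v l * slope (sqn q) (coord s q l))).
by rewrite /coord /= mul0r add0r /dslope ![_ * slope _ _]mulrC.
Qed.

(** The patch stays on a level set of G, to which the gradient is normal. *)
Lemma tangent_normal i s v q : s ^+ 2 = 1 ->
  dotv ('D_v (patch i s) q) (normal_field (patch i s q)) = 0.
Proof.
move=> s1; rewrite derive_patch normal_fieldZ dotvC dotvZl dotvC.
rewrite dotvDl !dotvZl dotv_face_normal// dotv_face0_normal//.
have := radius_gauge k eps_gt0 q.
move: (radius q) (_ ^+ m) (gauge q) (dslope q v) => r L g d Lg.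
rewrite (_ : _ + _ = r * d * (1 - L * g)); last by ring.
by rewrite Lg subrr !mulr0.
Qed.

(** The Hessian form of G divided by 2m. *)
Definition hess x (a b : 'rV[R]_3) : R :=
  \sum_(j < 3) ((x 0 j ^+ 2) ^+ k + eps * dotv x x ^+ k
      + 2 * k%:R * ((x 0 j ^+ 2) ^+ k.-1 * x 0 j ^+ 2)) * (a 0 j * b 0 j)
  + 2 * k%:R * eps * dotv x x ^+ k.-1 * (dotv x a * dotv x b).

Lemma hessC x a b : hess x a b = hess x b a.
Proof.
rewrite /hess [dotv x a * _]mulrC; congr (_ + _).
by apply: eq_bigr => j _; rewrite [a 0 j * _]mulrC.
Qed.

(** The Hessian is the variation of [normal_field] paired with the second vector,
    in the form in which the derivative of [normal_field] is computed. *)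
Lemma hess_variation x a b : hess x a b = \sum_(j < 3) b 0 j *
  (((x 0 j ^+ 2) ^+ k + eps * dotv x x ^+ k
      + 2 * k%:R * ((x 0 j ^+ 2) ^+ k.-1 * x 0 j ^+ 2)) * a 0 j +
   2 * k%:R * eps * dotv x x ^+ k.-1 * dotv x a * x 0 j).
Proof.
under [RHS]eq_bigr do rewrite mulrDr.
rewrite big_split /=; congr (_ + _).
  by apply: eq_bigr => j _; rewrite [RHS]mulrCA [b 0 j * _]mulrC.
rewrite mulrA {2}/dotv mulr_sumr; apply: eq_bigr => j _.
by rewrite [RHS]mulrCA [b 0 j * _]mulrC.
Qed.

Lemma hess_combination x c a d b e :
  hess x (c *: a + d *: b) e = c * hess x a e + d * hess x b e.
Proof.
have xE : dotv x (c *: a + d *: b) = c * dotv x a + d * dotv x b.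
  by rewrite dotvC dotvDl !dotvZl ![dotv _ x]dotvC.
have sE (h : 'I_3 -> R) : \sum_(j < 3) h j * ((c *: a + d *: b) 0 j * e 0 j) =
    c * (\sum_(j < 3) h j * (a 0 j * e 0 j)) +
    d * (\sum_(j < 3) h j * (b 0 j * e 0 j)).
  by rewrite !mulr_sumr -big_split; apply: eq_bigr => j _; rewrite !mxE /=; ring.
by rewrite /hess xE sE; ring.
Qed.

(** The Hessian of eps * |x| ^ 2m is positive definite. The Hessian of
    x_0 ^ 2m + x_1 ^ 2m + x_2 ^ 2m is nonnegative, and for m > 1 it degenerates on
    the coordinate planes. *)
Lemma hess_gt0 x a : x != 0 -> a != 0 -> 0 < hess x a a.
Proof.
rewrite -!dotv_gt0 => x0 a0; rewrite /hess ltr_wpDr//.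
  apply: mulr_ge0; last by rewrite -expr2 sqr_ge0.
  apply: mulr_ge0; last exact/exprn_ge0/ltW.
  by apply: mulr_ge0 (ltW eps_gt0); rewrite -natrM ler0n.
have e0 : 0 < eps * dotv x x ^+ k by rewrite mulr_gt0// exprn_gt0.
apply: (@lt_le_trans _ _ (eps * dotv x x ^+ k * dotv a a)); first exact: mulr_gt0.
rewrite [in leLHS]/dotv mulr_sumr; apply: ler_sum => j _.
apply: ler_wpM2r; first by rewrite -expr2 sqr_ge0.
have p0 := exprn_ge0 k (sqr_ge0 (x 0 j)).
have p1 : 0 <= 2 * k%:R * ((x 0 j ^+ 2) ^+ k.-1 * x 0 j ^+ 2).
  apply: mulr_ge0; first by rewrite -natrM ler0n.
  by apply: mulr_ge0; [exact/exprn_ge0/sqr_ge0|exact: sqr_ge0].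
by lra.
Qed.

(** The form is positive on the combination of a and b that is orthogonal to a for
    the form, which does not vanish since a and b are independent. *)
Lemma hess_det_gt0 x a b : x != 0 ->
  0 < dotv a a * dotv b b - dotv a b ^+ 2 ->
  0 < hess x a a * hess x b b - hess x a b ^+ 2.
Proof.
move=> x0 ab0.
have a0 : a != 0.
  have z y : dotv 0 y = 0 by apply: big1 => l _; rewrite mxE mul0r.
  by apply/eqP => a0; move: ab0; rewrite a0 !z mul0r expr0n subrr ltxx.
have A0 := hess_gt0 x0 a0.
set A := hess x a a in A0 *; set B := hess x a b.
rewrite -(pmulr_rgt0 _ A0).
have -> : A * (A * hess x b b - B ^+ 2) =
    hess x ((- B) *: a + A *: b) ((- B) *: a + A *: b).
  rewrite hess_combination ![hess x _ (_ + _)]hessC !hess_combination [hess x b a]hessC.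
  by rewrite -/A -/B; ring.
apply: hess_gt0 => //; apply/eqP => t0.
have Ab : A *: b = B *: a.
  by apply/eqP; rewrite -subr_eq0 addrC -scaleNr; apply/eqP.
have h c : A * dotv b c = B * dotv a c by rewrite -!dotvZl Ab.
have := mulr_gt0 (exprn_gt0 2 A0) ab0.
rewrite [X in 0 < X](_ : _ = A * dotv a a * (A * dotv b b) -
  (A * dotv b a) * (A * dotv b a)); last by rewrite [dotv b a]dotvC; ring.
rewrite !h [X in 0 < X](_ : _ =
  B * dotv a a * (A * dotv a b - B * dotv a a)); last by ring.
by rewrite [dotv a b]dotvC h subrr mulr0 ltxx.
Qed.

Lemma is_derive_normal_field (X : R * R -> 'rV[R]_3) v q (A : 'rV[R]_3) j :
  (forall l, is_derive q v (fun q => X q 0 l) (A 0 l)) ->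
  is_derive q v (fun q => normal_field (X q) 0 j)
  (((X q 0 j ^+ 2) ^+ k + eps * dotv (X q) (X q) ^+ k
      + 2 * k%:R * ((X q 0 j ^+ 2) ^+ k.-1 * X q 0 j ^+ 2)) * A 0 j +
   2 * k%:R * eps * dotv (X q) (X q) ^+ k.-1 * dotv (X q) A * X q 0 j).
Proof.
move=> dX.
have dN : is_derive q v (fun q => dotv (X q) (X q)) (2 * dotv (X q) A).
  rewrite (_ : (fun q => _) = \sum_(l < 3) ((fun q => X q 0 l) * (fun q => X q 0 l))).
    apply: is_derive_eq; rewrite [in RHS]/dotv mulr_sumr.
    by apply: eq_bigr => l _; rewrite /GRing.scale /=; ring.
  by apply/funext => y; rewrite fct_sumE.
rewrite (_ : (fun q => _) = (fun q => slope (dotv (X q) (X q)) (X q 0 j))); last first.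
  by apply/funext => y; rewrite mxE.
have /is_derive_eq := is_deriveM (dX j) (is_deriveD
   (is_derive_pow k (is_derive_pow 2 (dX j))) (is_deriveZ eps (is_derive_pow k dN))).
apply; rewrite /GRing.scale /=.
rewrite [X in _ + X * _ = _](_ : _ =
  (X q 0 j ^+ 2) ^+ k + eps * dotv (X q) (X q) ^+ k)//.
move: (k%:R) (dotv (X q) A) (dotv (X q) (X q) ^+ k.-1) => K D N'.
move: ((X q 0 j ^+ 2) ^+ k.-1) (X q 0 j) (A 0 j) => P x a.
by ring.
Qed.

(** Differentiating X_w . N = 0 in the direction v gives
    X_wv . N = - X_w . N_v, and N_v is the Hessian applied to X_v. *)
Lemma second_derivative_normal i s v w q : s ^+ 2 = 1 ->
  - dotv ('D_v (fun q' => 'D_w (patch i s) q') q) (normal_field (patch i s q)) =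
  hess (patch i s q) ('D_v (patch i s) q) ('D_w (patch i s) q).
Proof.
move=> s1.
have eX := elementary_patch i s.
have eT := elementary_map_derive eps_gt0 w eX.
have dcoord (Y : R * R -> 'rV[R]_3) l : elementary_map k eps Y ->
    is_derive q v (fun q => Y q 0 l) ('D_v Y q 0 l).
  move=> eY; have [/(_ q) dY _] := elementary_derive eps_gt0 (eY l).
  apply: DeriveDef; first exact: diff_derivable.
  rewrite derive_mx ?mxE//.
  exact/diff_derivable/(elementary_map_differentiable eps_gt0).
have dN j := is_derive_normal_field j (fun l => dcoord _ l eX).
have dT j := dcoord _ j eT.
have dh : is_derive q v
    (\sum_(j < 3) ((fun q => 'D_w (patch i s) q 0 j) *
       (fun q => normal_field (patch i s q) 0 j))) 0.
  rewrite (_ : \sum_(j < 3) _ = cst 0); first exact: is_derive_cst.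
  by apply/funext => y; rewrite fct_sumE -[RHS](tangent_normal i w y s1).
have := derive_val (is_derive := dh).
rewrite (derive_val (is_derive := is_derive_sum (fun j => is_deriveM (dT j) (dN j)))).
rewrite big_split /= => /eqP; rewrite addrC addr_eq0 => /eqP E.
rewrite {1}/dotv; transitivity (- \sum_(j < 3)
    normal_field (patch i s q) 0 j *: 'D_v ('D_w (patch i s)) q 0 j).
  by congr (- _); apply: eq_bigr => j _; rewrite /GRing.scale /= mulrC.
by rewrite E opprK -hess_variation.
Qed.

Lemma normal_field_neq0 x : x != 0 -> normal_field x != 0.
Proof.
move=> x0; have [j xj] := row_neq0_coord x0.
apply/eqP => /rowP /(_ j); rewrite !mxE /slope => /eqP; rewrite mulf_eq0.
rewrite (negbTE xj) /= => /eqP E.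
have := @ltr_wpDl _ _ _ _ (exprn_ge0 k (sqr_ge0 (x 0 j)))
  (mulr_gt0 eps_gt0 (exprn_gt0 k (_ : 0 < dotv x x))).
by rewrite E ltxx dotv_gt0; move=> /(_ x0).
Qed.

Lemma cube_gauge_lt x y : (forall j, x 0 j ^+ 2 <= y 0 j ^+ 2) ->
  dotv x x < dotv y y -> cube_gauge x < cube_gauge y.
Proof.
move=> xy n; rewrite /cube_gauge ler_ltD//.
  by apply: ler_sum => j _; rewrite lerXn2r// nnegrE sqr_ge0.
by rewrite ltr_pM2l// ltrXn2r// dotv_ge0.
Qed.

(** Each coordinate of the normal has the sign of the coordinate of x, so that the
    squares of the coordinates do not decrease along the ray and G increases.
    The whole ray is therefore a connected unbounded set in the complement. *)
Lemma exterior_normal_ray x (c t : R) : rounded_cube x -> 0 < c -> 0 < t ->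
  exterior rounded_cube (x + t *: (c *: normal_field x)).
Proof.
move=> Sx c0 t0; set N := c *: normal_field x.
have x0 := rounded_cube_neq0 Sx.
have N0 : N != 0 by rewrite scaler_eq0 gt_eqF//= normal_field_neq0.
have xN j : 0 <= x 0 j * N 0 j.
  rewrite !mxE /slope mulrCA; apply: mulr_ge0; first exact: ltW.
  rewrite mulrA -expr2; apply: mulr_ge0; first exact: sqr_ge0.
  apply: addr_ge0; first exact/exprn_ge0/sqr_ge0.
  by apply: mulr_ge0; [exact: ltW|exact/exprn_ge0/dotv_ge0].
have out u : 0 < u -> ~ rounded_cube (x + u *: N).
  move=> u0 Sy; suff : cube_gauge x < cube_gauge (x + u *: N).
    by rewrite Sx Sy ltxx.
  have sqE j : (x + u *: N) 0 j ^+ 2 =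
      x 0 j ^+ 2 + (2 * u * (x 0 j * N 0 j) + u ^+ 2 * N 0 j ^+ 2).
    by rewrite !mxE; ring.
  have u2 := exprn_gt0 2 u0.
  apply: cube_gauge_lt => [j|].
    rewrite sqE lerDl addr_ge0// mulr_ge0 ?sqr_ge0 ?xN//.
    by rewrite mulr_ge0// ltW.
  rewrite [ltRHS](_ : _ = dotv x x + (2 * u * dotv x N + u ^+ 2 * dotv N N)).
    rewrite ltrDl ltr_wpDl//; last by rewrite mulr_gt0// dotv_gt0.
    by apply: mulr_ge0; [rewrite mulr_ge0// ltW|exact: sumr_ge0].
  rewrite [in LHS]/dotv [in RHS]/dotv !mulr_sumr -!big_split /=.
  by apply: eq_bigr => j _; rewrite -expr2 sqE; ring.
set ray := [set x + u *: N | u in `]0, +oo[].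
(* the component of x + t * N contains the ray *)
have ray_out : ray `<=` ~` rounded_cube.
  by move=> _ [u + <-]; rewrite /= in_itv /= andbT => /out.
have ray_t : ray (x + t *: N) by exists t => //; rewrite /= in_itv /= t0.
have ray_connected : connected ray.
  apply: connected_continuous_connected.
    exact/connected_intervalP/interval_is_interval.
  apply: continuous_subspaceT => u.
  by apply: cvgD; [exact: cvg_cst|apply: cvgZl; exact: cvg_id].
split; first exact: out.
move=> [M [_ HM]].
have {}HM u : 0 < u -> `|x + u *: N| <= M + 1.
  move=> u0; apply: HM; first by rewrite ltrDl.
  apply: (connected_component_max ray_t ray_out ray_connected).
  by exists u => //; rewrite /= in_itv /= u0.
have nN : 0 < `|N| by rewrite normr_gt0.
(* a parameter at which the ray has left the ball of radius M + 1 *)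
have := HM ((`|M + 1| + `|x| + 1) / `|N|) _.
rewrite leNgt => /(_ _)/negP; apply; first by rewrite divr_gt0// ltr_wpDl// addr_ge0.
set u := _ / _.
have u0 : 0 <= u by rewrite divr_ge0// !addr_ge0.
have : `|u *: N| = `|M + 1| + `|x| + 1.
  by rewrite normrZ (ger0_norm u0) /u divfK// gt_eqF.
have := lerB_normD (u *: N) x; rewrite [u *: N + x]addrC => /[swap] ->.
apply: lt_le_trans; rewrite addrAC addrK.
by rewrite ltr_pwDr// ler_norm.
Qed.

Lemma outward_normal_patch i s q : s ^+ 2 = 1 ->
  let N := normal_field (patch i s q) in
  outward_unit_normal rounded_cube (patch i s) q ((Num.sqrt (dotv N N))^-1 *: N).
Proof.
move=> s1 N; have Sx := patch_surface i q s1.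
have N0 : 0 < dotv N N.
  by rewrite dotv_gt0 normal_field_neq0// rounded_cube_neq0.
split.
- rewrite dotvZl dotvC dotvZl mulrA -expr2 exprVn sqr_sqrtr ?ltW//.
  by rewrite mulVf// gt_eqF.
- move=> l; rewrite dotvC dotvZl dotvC (_ : row l _ = 'D_(basis2 R l) (patch i s) q).
    by rewrite tangent_normal// mulr0.
  by apply/rowP => j; rewrite !mxE.
- exists 1 => // t /andP[t0 _]; apply: exterior_normal_ray => //.
  by rewrite invr_gt0 sqrtr_gt0.
Qed.

Lemma strictly_convex_rounded_cube : strictly_convex rounded_cube.
Proof.
move=> x Sx; have [i xi0] := row_neq0_coord (rounded_cube_neq0 Sx).
have s1 : Num.sg (x 0 i) ^+ 2 = 1 by rewrite sqr_sg xi0.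
have xE : patch i (Num.sg (x 0 i)) (proj i (Num.sg (x 0 i)) x) = x.
  by apply: patch_proj => //; rewrite -normrEsg normr_gt0.
move: (Num.sg _) (proj _ _ _) s1 xE => s q s1 xE.
have [n1 n2 n3] := outward_normal_patch i q s1.
set N := normal_field _ in n1 n2 n3; set c := (Num.sqrt (dotv N N))^-1 in n1 n2 n3.
have c0 : 0 < c.
  rewrite invr_gt0 sqrtr_gt0 dotv_gt0 normal_field_neq0// xE.
  exact: rounded_cube_neq0.
have [T [fE sE]] : exists T : 'I_2 -> 'rV[R]_3,
    (forall a b, first_form (patch i s) q a b = dotv (T a) (T b)) /\
    (forall a b, second_form (patch i s) (c *: N) q a b = c * hess x (T a) (T b)).
  exists (fun a => 'D_(basis2 R a) (patch i s) q); split=> a b.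
    exact: first_formE.
  rewrite mxE dotvC dotvZl dotvC -mulrN second_derivative_normal//.
  by rewrite xE.
have d0 := det_first_form_gt0 i q s1.
have x0 := rounded_cube_neq0 Sx.
have g0 : 0 < dotv (T 0) (T 0) * dotv (T 1) (T 1) - dotv (T 0) (T 1) ^+ 2.
  by move: d0; rewrite det2 !fE [dotv (T 1) (T 0)]dotvC -expr2.
have T0 : T 0 != 0.
  apply/eqP => T0; move: g0; rewrite T0.
  have z y : dotv 0 y = 0 by apply: big1 => l _; rewrite mxE mul0r.
  by rewrite !z mul0r expr0n subrr ltxx.
have [||||||k1 [k2 [k1k2 k10 k20]]] :=
    @pencil_roots _ (first_form (patch i s) q) (second_form (patch i s) (c *: N) q).
- by rewrite fE dotv_gt0.
- by rewrite !fE dotvC.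
- exact: d0.
- by rewrite sE mulr_gt0// hess_gt0.
- by rewrite !sE hessC.
- rewrite det2 !sE [hess x (T 1) (T 0)]hessC.
  rewrite [ltRHS](_ : _ = c ^+ 2 * (hess x (T 0) (T 0) * hess x (T 1) (T 1) -
    hess x (T 0) (T 1) ^+ 2)); last by ring.
  by rewrite mulr_gt0 ?exprn_gt0 ?hess_det_gt0.
exists k1, k2; split=> //; exists setT, (patch i s), q, (c *: N); split=> //.
exact: local_param_patch.
Qed.

(** * Decomposition into tiles *)

(** The end points are dropped against the faces of smaller index, so that a point
    with several coordinates of largest absolute value belongs to exactly one tile. *)
Definition side (j i : 'I_3) : interval R :=
  if (j < i)%N then `]-1, 1[ else `[-1, 1].

Local Notation plane := (measurableTypeR R * measurableTypeR R)%type.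

Definition tile (i : 'I_3) : set plane :=
  [set` side (i + 1) i] `*` [set` side (i - 1) i].

(** The index i is the least one at which |x_i| is maximal. *)
Definition dominant (i : 'I_3) x := forall j,
  if (j < i)%N then `|x 0 j| < `|x 0 i| else `|x 0 j| <= `|x 0 i|.

Lemma in_side j i (t a : R) : 0 < a ->
  (t / a \in side j i) = if (j < i)%N then `|t| < a else `|t| <= a.
Proof.
move=> a0; rewrite /side; case: ifP => _; rewrite in_itv /=.
  by rewrite ltr_pdivlMr// ltr_pdivrMr// mulN1r mul1r -ltr_norml.
by rewrite ler_pdivlMr// ler_pdivrMr// mulN1r mul1r -ler_norml.
Qed.

Lemma ord3_cases (l : 'I_3) : [\/ l = 0, l = 1 | l = -1].
Proof.
by case: l => -[|[|[|//]]] l3; [constructor 1|constructor 2|constructor 3];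
  exact/val_inj.
Qed.

Lemma image_tile i s x : s ^+ 2 = 1 ->
  (patch i s @` tile i) x <-> [/\ rounded_cube x, 0 < s * x 0 i & dominant i x].
Proof.
move=> s1.
have tileE : 0 < s * x 0 i -> tile i (proj i s x) <-> dominant i x.
  move=> c0; have cE : s * x 0 i = `|x 0 i|.
    have n1 : `|s| = 1.
      by apply/eqP; rewrite -(@eqrXn2 _ 2%N)// expr1n real_normK ?num_real// s1.
    by rewrite -[LHS]ger0_norm ?ltW// normrM n1 mul1r.
  rewrite /tile /proj cE /=; rewrite cE in c0; split=> [[/= t1 t2] j|dx].
    have [jE|jE|jE] := ord3_cases (j - i); rewrite -(subrK i j) jE.
    - by rewrite add0r ltnn.
    - by rewrite addrC -in_side.
    - by rewrite addrC -in_side.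
  by split; rewrite /= in_side//; exact: dx.
split=> [[q tq qx]|[Sx c0 /(tileE c0) tx]].
  have c0 : 0 < s * x 0 i.
    rewrite -qx !mxE subrr /coord eqxx mulrCA -expr2 s1 mulr1.
    exact: radius_gt0.
  split=> //; first by rewrite -qx; exact: patch_surface.
  by apply/(tileE c0); rewrite -qx proj_patch.
by exists (proj i s x) => //; exact: patch_proj.
Qed.

Lemma dominant_unique x i i' : dominant i x -> dominant i' x -> i = i'.
Proof.
have dlt l l' : dominant l x -> dominant l' x -> ~~ (l < l')%N.
  move=> dl dl'; apply/negP => ll'.
  have := dl l'; have := dl' l; rewrite ll' ltnNge (ltnW ll') /=.
  by move=> /lt_le_trans /[apply]; rewrite ltxx.
move=> di di'; apply/val_inj/eqP; rewrite eqn_leq leqNgt dlt//.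
by rewrite leqNgt dlt.
Qed.

Lemma dominant_exists x : exists i, dominant i x.
Proof.
have [i1 _ i1P] := @arg_maxP _ _ _ (ord0 : 'I_3) xpredT (fun j => `|x 0 j|) isT.
have i1max : [forall j, `|x 0 j| <= `|x 0 i1|] by apply/forallP => j; exact: i1P.
have [i /forallP imax imin] :=
  @arg_minnP _ i1 (fun i => [forall j, `|x 0 j| <= `|x 0 i|]) val i1max.
exists i => j; case: ifPn => // ji; rewrite ltNge; apply/negP => ij.
have : (i <= j)%N.
  by apply: imin; apply/forallP => l; apply: le_trans ij; exact: imax.
by rewrite leqNgt ji.
Qed.

(** The six faces: the indices 0, 1, 2 are for the sign 1, and 3, 4, 5 for -1. *)
Definition face_index (a : 'I_6) : 'I_3 := inord (a %% 3).

Definition face_sign (a : 'I_6) : R := if (a < 3)%N then 1 else -1.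

Lemma face_sign_sqr a : face_sign a ^+ 2 = 1.
Proof. by rewrite /face_sign; case: ifP => _; rewrite ?sqrrN expr1n. Qed.

Definition face_patch a := patch (face_index a) (face_sign a).

Lemma tiles_cover :
  rounded_cube = \bigcup_a (face_patch a @` tile (face_index a)).
Proof.
apply/seteqP; split=> [x Sx|x [a _]]; last first.
  by move=> /(image_tile _ _ (face_sign_sqr a))[].
have [i di] := dominant_exists x.
have xi0 : x 0 i != 0.
  have [j xj] := row_neq0_coord (rounded_cube_neq0 Sx).
  rewrite -normr_gt0; apply: (@lt_le_trans _ _ `|x 0 j|); first by rewrite normr_gt0.
  by have := di j; case: ifP => _; [exact: ltW|].
have [a ia sa] : exists2 a : 'I_6, face_index a = i & 0 < face_sign a * x 0 i.
  have i3 := ltn_ord i; have i6 : (i < 6)%N by exact: ltn_trans i3 _.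
  have i36 : (i + 3 < 6)%N by rewrite (ltn_add2r 3 i 3).
  have [x0|x0] := ltP 0 (x 0 i).
    exists (inord i); rewrite /face_index /face_sign inordK//.
      by rewrite modn_small// inord_val.
    by rewrite i3 mul1r.
  exists (inord (i + 3)); rewrite /face_index /face_sign inordK//.
    by rewrite modnDr modn_small// inord_val.
  by rewrite ltnNge leq_addl/= mulN1r oppr_gt0 lt_neqAle xi0.
exists a => //; apply/image_tile; first exact: face_sign_sqr.
by rewrite ia.
Qed.

Lemma tiles_disjoint :
  trivIset setT (fun a => face_patch a @` tile (face_index a)).
Proof.
have opp (t : R) : 0 < t -> 0 < - t -> False by move=> ? ?; lra.
move=> a b _ _ [x [/(image_tile _ _ (face_sign_sqr a))[_ xa da]
  /(image_tile _ _ (face_sign_sqr b))[_ xb db]]].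
have iab := dominant_unique da db.
have m3 : (a %% 3 = b %% 3)%N.
  rewrite -(@inordK 2 (a %% 3)) ?ltn_mod// -(@inordK 2 (b %% 3)) ?ltn_mod//.
  by rewrite -/(face_index a) iab.
have s3 : (a < 3)%N = (b < 3)%N.
  move: xa xb; rewrite iab /face_sign.
  case: ifP => _; case: ifP => _ //; rewrite mul1r mulN1r => t0 t1.
    by case: (opp _ t0 t1).
  by case: (opp _ t1 t0).
apply/val_inj; move: m3 s3; case: a {xa da iab} => -[|[|[|[|[|[|//]]]]]] ?;
by case: b {xb db} => -[|[|[|[|[|[|//]]]]]] ?.
Qed.

(** * Area and moment *)

Lemma measurable_elementary f : elementary k eps f ->
  measurable_fun setT (f : plane -> R).
Proof.
have m1 : measurable_fun setT (fst : plane -> R) by exact: measurable_fst.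
have m2 : measurable_fun setT (snd : plane -> R) by exact: measurable_snd.
have ms := @measurable_sqn R.
have mg : measurable_fun setT (gauge : plane -> R).
  apply: measurable_funD; last by apply: measurable_funM => //; exact: measurable_funX.
  do 2 ?[apply: measurable_funD; last by do 2 apply: measurable_funX].
  exact: measurable_cst.
elim=> {f} [c||||f g _ mf _ mg'|f g _ mf _ mg'] //.
- rewrite (_ : radius = (@powR R ^~ (- (2 * m%:R)^-1)) \o gauge)//.
  by apply: measurableT_comp mg; exact: measurable_powR.
- exact: measurable_funD.
- exact: measurable_funM.
Qed.

Definition density q : R :=
  radius q ^+ 2 * (radius q ^+ 2) ^+ m * Num.sqrt (normal_sq q).

Lemma measurable_density : measurable_fun setT (density : plane -> R).
Proof.
have er : elementary k eps (fun q => radius q ^+ 2).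
  by apply: elementary_exp; constructor.
apply: measurable_funM.
  exact: (measurable_elementary (elementary_mul er (elementary_exp m er))).
apply: (measurableT_comp (continuous_measurable_fun (@sqrt_continuous R))).
apply: measurable_elementary; rewrite /normal_sq.
do 2 ?[apply: elementary_add; last by apply: elementary_exp;
  apply: elementary_slope; constructor].
apply: (@elementary_exp _ _ _ (fun q => 1 + eps * sqn q ^+ k)).
apply: (@elementary_add _ _ _ (fun=> 1)); first exact: elementary_cst.
apply: (@elementary_mul _ _ _ (fun=> eps)); first exact: elementary_cst.
exact/elementary_exp/elementary_sqn.
Qed.

Lemma density_ge0 q : 0 <= density q.
Proof.
apply: mulr_ge0 (sqrtr_ge0 _); apply: mulr_ge0; first exact: sqr_ge0.
exact/exprn_ge0/sqr_ge0.
Qed.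

Lemma radius_sqX_gauge q : (radius q ^+ 2) ^+ m = (gauge q)^-1.
Proof.
have g0 := gauge_gt0 k eps_gt0 q; apply: (mulIf (lt0r_neq0 g0)).
by rewrite radius_gauge// mulVf// gt_eqF.
Qed.

Lemma radius_sq_le1 q : radius q ^+ 2 <= 1.
Proof.
rewrite -(expr_le1 (ltn0Sn k)) ?sqr_ge0// radius_sqX_gauge.
by rewrite invf_le1 ?gauge_gt0 ?gauge_ge1.
Qed.

(** Over the square, the distance radius * gauge / sqrt normal_sq from the origin to
    the tangent plane is at least the radius. The difference of the two sides is a sum of
    terms that are nonnegative because |u|, |v| <= 1 <= sqn. *)
Lemma normal_sq_le q : q.1 ^+ 2 <= 1 -> q.2 ^+ 2 <= 1 ->
  normal_sq q <= gauge q ^+ 2.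
Proof.
move=> u1 v1.
have n1 := sqn_ge1 q; have n0 := sqn_gt0 q.
have -> : gauge q = 1 + q.1 ^+ 2 * (q.1 ^+ 2) ^+ k + q.2 ^+ 2 * (q.2 ^+ 2) ^+ k +
    eps * sqn q ^+ k * sqn q.
  by rewrite /gauge !exprS; ring.
rewrite /normal_sq /slope.
have e0 : 0 <= eps * sqn q ^+ k by rewrite mulr_ge0 ?ltW// exprn_gt0.
have U1 := exprn_ile1 k (sqr_ge0 q.1) u1.
have V1 := exprn_ile1 k (sqr_ge0 q.2) v1.
have U0 := exprn_ge0 k (sqr_ge0 q.1).
have V0 := exprn_ge0 k (sqr_ge0 q.2).
move: ((q.1 ^+ 2) ^+ k) ((q.2 ^+ 2) ^+ k) (eps * _) U0 U1 V0 V1 e0 => P Q e U0 U1 V0 V1 e0.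
rewrite -subr_ge0.
set p := q.1 ^+ 2 * P; set r := q.2 ^+ 2 * Q.
have p0 : 0 <= p by rewrite mulr_ge0 ?sqr_ge0.
have r0 : 0 <= r by rewrite mulr_ge0 ?sqr_ge0.
(* gauge ^ 2 - normal_sq as a sum of nonnegative terms *)
rewrite (_ : _ - _ = (p * (1 - P) + r * (1 - Q) + p + r + (p + r) ^+ 2) +
    2 * (e * (sqn q - 1) * (1 + p + r)) + e ^+ 2 * (sqn q * (sqn q - 1))); last first.
  by rewrite /p /r /sqn; ring.
have n2 : 0 <= sqn q - 1 by rewrite subr_ge0.
have pP : 0 <= p * (1 - P) by rewrite mulr_ge0// subr_ge0.
have rQ : 0 <= r * (1 - Q) by rewrite mulr_ge0// subr_ge0.
have pr : 0 <= 1 + p + r by rewrite !addr_ge0.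
apply: addr_ge0; last by rewrite !mulr_ge0 ?sqr_ge0// ltW.
apply: addr_ge0; last by rewrite !mulr_ge0.
by rewrite !addr_ge0// sqr_ge0.
Qed.

Lemma density_le q : q.1 ^+ 2 <= 1 -> q.2 ^+ 2 <= 1 -> density q <= 1.
Proof.
move=> u1 v1; have g0 := gauge_gt0 k eps_gt0 q.
apply: (@le_trans _ _ (radius q ^+ 2)); last exact: radius_sq_le1.
rewrite /density -mulrA ler_piMr ?sqr_ge0// radius_sqX_gauge.
rewrite mulrC ler_pdivrMr// mul1r -[leRHS](ger0_norm (ltW g0)) -sqrtr_sqr.
by rewrite ler_wsqrtr// normal_sq_le.
Qed.

(** The normal has norm at least 1, and since the radius is at most 1 its square
    is at least its power 2m, which is 1 / gauge. *)
Lemma density_ge q c : gauge q <= c -> c ^- 2 <= density q.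
Proof.
move=> gc; have g0 := gauge_gt0 k eps_gt0 q.
have r0 : 0 <= (radius q ^+ 2) ^+ m by exact/exprn_ge0/sqr_ge0.
apply: (@le_trans _ _ ((gauge q)^-1 ^+ 2)).
  have c0 := lt_le_trans g0 gc.
  rewrite -exprVn; apply: lerXn2r; rewrite ?nnegrE ?invr_ge0 ?(ltW c0) ?(ltW g0)//.
  by rewrite lef_pV2 ?posrE.
rewrite -radius_sqX_gauge expr2 /density.
apply: (@le_trans _ _ (radius q ^+ 2 * (radius q ^+ 2) ^+ m)).
  apply: ler_wpM2r => //.
  by rewrite exprS ler_piMr ?sqr_ge0// exprn_ile1 ?sqr_ge0// radius_sq_le1.
apply: ler_peMr; first by apply: mulr_ge0 => //; exact: sqr_ge0.
by rewrite -{1}sqrtr1 ler_wsqrtr// normal_sq_ge1.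
Qed.

Local Notation mu := (@lebesgue_measure R).
Local Notation square a := (`[- a, a] `*` `[- a, a] : set plane).

Lemma measurable_tile i : measurable (tile i).
Proof. by apply: measurableX; exact: measurable_itv. Qed.

Lemma subset_side j i : `]-1, 1[%classic `<=` [set` side j i].
Proof.
rewrite /side => t; case: ifP => _ //=; rewrite !in_itv /= => /andP[? ?].
by rewrite !ltW.
Qed.

Lemma side_subset j i : [set` side j i] `<=` `[- 1, 1]%classic.
Proof.
rewrite /side => t; case: ifP => _ //=; rewrite !in_itv /= => /andP[? ?].
by rewrite !ltW.
Qed.

(** By symmetry the integrand h is the same on the six tiles, and each tile lies
    between the squares [-a, a]^2 for a < 1 and the square [-1, 1]^2. *)
Lemma surface_integral_rounded_cube (f : 'rV[R]_3 -> R) (h : plane -> R) (c : R) :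
  measurable_fun setT h -> (forall q, 0 <= h q) ->
  (forall i s q, s ^+ 2 = 1 ->
    f (patch i s q) * area_density (patch i s) q = h q) ->
  (\int[mu \x mu]_(q in square 1) (h q)%:E <= c%:E)%E ->
  exists I, [/\ surface_integral rounded_cube f I, I <= 6 * c &
    forall a b, a < 1 ->
      (b%:E <= \int[mu \x mu]_(q in square a) (h q)%:E)%E -> 6 * b <= I].
Proof.
move=> mh h0 fh hc.
have mhE : measurable_fun setT (EFin \o h) by exact/measurable_EFinP.
pose J a := (\int[mu \x mu]_(q in tile (face_index a)) (h q)%:E)%E.
have J0 a : (0 <= J a)%E by apply: integral_ge0 => q _; rewrite lee_fin.
have mS (a : R) : measurable (square a) by exact: measurable_square.
have Jc a : (J a <= c%:E)%E.
  apply: le_trans hc; apply: ge0_subset_integral => //.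
  - exact: measurable_tile.
  - exact: measurable_funS mhE.
  - by move=> q _; rewrite lee_fin.
  - by move=> q [q1 q2]; split; [exact: side_subset q1|exact: side_subset q2].
have Jfin a : J a \is a fin_num.
  by rewrite ge0_fin_numE//; exact: le_lt_trans (Jc a) (ltry _).
have sum6 (t : R) : \sum_(a < 6) t = 6 * t.
  by rewrite sumr_const card_ord mulr_natl.
exists (\sum_(a < 6) fine (J a)); split.
- exists 6%N, (fun=> setT), (fun a => tile (face_index a)), face_patch; split.
  + by move=> a; exact/local_param_patch/face_sign_sqr.
  + by move=> a; split=> //; exact: measurable_tile.
  + exact: tiles_cover.
  + exact: tiles_disjoint.
  + rewrite -sumEFin; apply: eq_bigr => a _; rewrite fineK//.
    by apply: eq_integral => q _; rewrite -(fh (face_index a) _ _ (face_sign_sqr a)).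
- rewrite -sum6; apply: ler_sum => a _.
  by rewrite -lee_fin fineK.
- move=> a b a1 hb; rewrite -sum6; apply: ler_sum => l _.
  rewrite -lee_fin fineK//; apply: le_trans hb _.
  apply: ge0_subset_integral => //.
  + exact: measurable_tile.
  + exact: measurable_funS mhE.
  + by move=> q _; rewrite lee_fin.
  + move=> q [/= q1 q2].
    have sub (t : R) : t \in `[- a, a] -> t \in `]-1, 1[.
      by rewrite !in_itv /= => /andP[? ?]; apply/andP; split; lra.
    by split; apply: subset_side; exact: sub.
Qed.

Lemma in_square a q : (square a) q -> q.1 ^+ 2 <= a ^+ 2 /\ q.2 ^+ 2 <= a ^+ 2.
Proof.
have sq (t : R) : t \in `[- a, a] -> t ^+ 2 <= a ^+ 2.
  rewrite in_itv /= -ler_norml => ta.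
  by rewrite -[t ^+ 2]real_normK ?num_real// lerXn2r// ?nnegrE// (le_trans _ ta).
by case=> /= /sq ? /sq.
Qed.

Lemma dotv_patch i s q : s ^+ 2 = 1 ->
  dotv (patch i s q) (patch i s q) = radius q ^+ 2 * sqn q.
Proof.
move=> s1; rewrite dotvZl dotvC dotvZl dotv_face -!expr2 s1.
by rewrite mulrA -expr2.
Qed.

Lemma moment_rounded_cube : exists M,
  surface_integral rounded_cube (fun x => eucl_dist x 0 ^+ 2) M /\ M <= 40.
Proof.
pose h q := radius q ^+ 2 * sqn q * density q.
have h0 q : 0 <= h q.
  rewrite mulr_ge0 ?density_ge0// mulr_ge0 ?sqr_ge0// ltW//; exact: sqn_gt0.
have mh : measurable_fun setT (h : plane -> R).
  apply: measurable_funM measurable_density.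
  apply: measurable_elementary; apply: elementary_mul (elementary_sqn _ _).
  by apply: elementary_exp; constructor.
have mhE : measurable_fun setT (EFin \o (h : plane -> R)).
  by apply/measurable_EFinP; exact: mh.
have msE : measurable_fun setT (EFin \o (@sqn R : plane -> R)).
  by apply/measurable_EFinP; exact: measurable_sqn.
have hle : (\int[mu \x mu]_(q in square 1) (h q)%:E <= (20 / 3)%:E)%E.
  rewrite -(integral_sqn R); apply: ge0_le_integral => //.
  - exact: measurable_square.
  - by move=> q _; rewrite lee_fin.
  - exact: measurable_funTS mhE.
  - exact: measurable_funTS msE.
  - move=> q /in_square; rewrite expr1n => -[q1 q2].
    rewrite lee_fin /h mulrAC ler_piMl ?(ltW (sqn_gt0 _))//.
    by rewrite mulr_ile1 ?sqr_ge0 ?density_ge0 ?radius_sq_le1 ?density_le.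
have hE i s q : s ^+ 2 = 1 ->
    eucl_dist (patch i s q) 0 ^+ 2 * area_density (patch i s) q = h q.
  move=> s1; rewrite area_density_patch// /eucl_dist subr0 sqr_sqrtr ?dotv_ge0//.
  by rewrite dotv_patch.
have [M [SM M6 _]] := surface_integral_rounded_cube
  (f := fun x => eucl_dist x 0 ^+ 2) mh h0 hE hle.
by exists M; split=> //; apply: le_trans M6 _; lra.
Qed.

Lemma area_rounded_cube (a c : R) : 0 <= a < 1 ->
  (forall q, (square a) q -> gauge q <= c) ->
  exists A, surface_area rounded_cube A /\ 24 * a ^+ 2 / c ^+ 2 <= A.
Proof.
move=> /andP[a0 a1] gc.
have mS (b : R) : measurable (square b) by exact: measurable_square.
have md : measurable_fun setT (EFin \o (density : plane -> R)).
  by apply/measurable_EFinP; exact: measurable_density.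
have cstE (r b : R) : 0 <= b ->
    (\int[mu \x mu]_(q in square b) (cst r%:E) q = (r * (2 * b) ^+ 2)%:E)%E.
  move=> b0; rewrite (@integral_cst _ _ R (mu \x mu)%E _ (mS b) r%:E) EFinM.
  by congr mule; exact: measure_square.
have dle : (\int[mu \x mu]_(q in square 1) (density q)%:E <= 4%:E)%E.
  have <- : (\int[mu \x mu]_(q in square 1) (cst 1%:E) q = 4%:E)%E.
    by rewrite cstE//; congr EFin; ring.
  apply: ge0_le_integral => //.
  - by move=> q _; rewrite lee_fin density_ge0.
  - exact: measurable_funTS.
  - move=> q /in_square; rewrite expr1n => -[q1 q2].
    by rewrite lee_fin density_le.
have dE i s q : s ^+ 2 = 1 -> 1 * area_density (patch i s) q = density q.
  by move=> s1; rewrite mul1r area_density_patch.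
have [A [SA _ Ab]] := surface_integral_rounded_cube (f := fun=> 1)
  measurable_density density_ge0 dE dle.
exists A; split=> //.
have := Ab a (c ^- 2 * (2 * a) ^+ 2) a1.
rewrite (_ : 6 * _ = 24 * a ^+ 2 / c ^+ 2); last by ring.
apply; rewrite -cstE//.
apply: ge0_le_integral => //.
- by move=> q _; rewrite lee_fin invr_ge0 sqr_ge0.
- exact: measurable_funTS.
- by move=> q /gc /density_ge; rewrite lee_fin.
Qed.

Lemma gauge_le (a : R) q : 0 <= a <= 1 -> (square a) q ->
  gauge q <= 1 + 2 * (a ^+ 2) ^+ m + eps * 3 ^+ m.
Proof.
move=> /andP[a0 a1] /in_square[q1 q2].
have aa : a ^+ 2 <= 1 by rewrite expr_le1.
rewrite /gauge (_ : 2 * _ = (a ^+ 2) ^+ m + (a ^+ 2) ^+ m); last by ring.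
rewrite addrA; apply: lerD; first apply: lerD; first apply: lerD => //.
- by rewrite lerXn2r ?nnegrE ?sqr_ge0.
- by rewrite lerXn2r ?nnegrE ?sqr_ge0.
rewrite ler_pM2l// lerXn2r ?nnegrE ?(ltW (sqn_gt0 _))//.
by rewrite /sqn; lra.
Qed.

End RoundedCube.

(** * The inequality *)

(** Since t * cos t <= sin t for t = pi / 8, a value of pi above 7 / 2 would give
    tan (pi / 8) > 7 / 16, which is incompatible with tan (pi / 4) = 1. *)
Lemma pi_le_7_2 (R : realType) : pi <= 7 / 2 :> R.
Proof.
set x : R := pi / 8.
have p0 : 0 < (pi : R) := pi_gt0 R.
have p2 : pi / 2 < 2 :> R := pihalf_lt2 R.
have x0 : 0 < x by rewrite /x; lra.
have x2 : x < 2 by rewrite /x; lra.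
(* F' t = t * sin t is nonnegative on the interval. *)
pose F (t : R) := sin t - t * cos t.
have dF (t : R) : is_derive t 1 F (t * sin t).
  have /is_derive_eq := is_deriveB (is_derive_sin t)
    (is_deriveM (is_derive_id t (1 : R)) (is_derive_cos t)).
  by apply; rewrite /GRing.scale /=; ring.
have [|c + Fc] := MVT x0 (fun t _ => dF t).
  apply: continuous_subspaceT => t.
  by apply/differentiable_continuous/derivable1_diffP; have [] := dF t.
rewrite in_itv /= => /andP[c0 cx].
have Fx : 0 <= F x.
  have F0 : F 0 = 0 by rewrite /F sin0 mul0r subr0.
  rewrite -[F x]subr0 -[X in _ - X]F0 Fc subr0.
  rewrite mulr_ge0 ?(ltW x0)// mulr_ge0 ?(ltW c0)// ltW// sin2_gt0//.
  by rewrite c0 (lt_trans cx).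
have xcs : x * cos x <= sin x by rewrite -subr_ge0.
have c_gt0 : 0 < cos x.
  by apply: cos_gt0_pihalf; apply/andP; split; rewrite /x; lra.
have x4 : x + x = pi / 4 by rewrite /x; field.
have sc : sin (x + x) = cos (x + x).
  have -> : sin (x + x) = cos (pi / 2 - (x + x)).
    by rewrite cosB cos_pihalf sin_pihalf mul0r mul1r add0r.
  by congr cos; rewrite x4; field.
move: sc; rewrite sinD cosD => sc.
rewrite leNgt; apply/negP => p7.
have x7 : 7 / 16 < x by rewrite /x; lra.
have s7 : 7 / 16 * cos x < sin x.
  by apply: lt_le_trans xcs; rewrite ltr_pM2r.
have := mulr_gt0 c_gt0 c_gt0.
move: (sin x) (cos x) s7 sc c_gt0 => s t s7 sc t0 tt.
have : (7 / 16 * t) * (7 / 16 * t) < s * s by apply: ltr_pM => //; lra.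
have : (7 / 16 * t) * t < s * t by rewrite ltr_pM2r.
lra.
Qed.

(** The numbers leave little room: 4 * (7 / 2) * 40 = 560 < 561.69 = 23.7 ^ 2. *)
Lemma moment_area_ratio (R : realType) (A M : R) :
  237 / 10 <= A -> M <= 40 -> A ^- 2 * M < 1 / omega2 R.
Proof.
move=> A0 M40; have pi0 := pi_gt0 R; have pi1 := pi_le_7_2 R.
have A2 : 0 < A ^+ 2 by rewrite exprn_gt0//; lra.
have w0 : 0 < omega2 R by rewrite /omega2; lra.
rewrite mulrC ltr_pdivrMr// mulrC -ltr_pdivrMr ?divr_gt0//.
rewrite div1r invrK; apply: (@le_lt_trans _ _ (40 * omega2 R)).
  by rewrite ler_wpM2r// ltW.
apply: (@le_lt_trans _ _ (40 * (4 * (7 / 2)))); first by rewrite /omega2; lra.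
apply: (@lt_le_trans _ _ ((237 / 10) ^+ 2)); first by lra.
by rewrite lerXn2r// nnegrE; lra.
Qed.

Theorem mainTheorem7 (R : realType) :
  exists Sigma : set 'rV[R]_3,
    [/\ closed_surface Sigma,
        star_shaped Sigma,
        strictly_convex Sigma &
        exists area moment : R,
          [/\ surface_area Sigma area,
              surface_integral Sigma (fun x => eucl_dist x 0 ^+ 2) moment &
              area ^- 2 * moment < 1 / omega2 R]].
Proof.
(* The area bound 24 * a ^ 2 / c ^ 2, with c = 1.001 a bound of the gauge on
   [-a, a]^2, has to exceed 23.7. *)
pose a : R := 199 / 200.
have a01 : 0 <= a < 1 by rewrite /a; apply/andP; split; lra.
have a01' : 0 <= a <= 1 by rewrite /a; apply/andP; split; lra.
have [k ak] : exists k, (a ^+ 2) ^+ k.+1 < 1 / 4000.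
  have : `|a ^+ 2| < 1 by rewrite ger0_norm ?sqr_ge0// /a; lra.
  move/cvg_expr => /cvgr_lt /(_ (1 / 4000)) [|N _ HN]; first by lra.
  by exists N; apply: (HN N.+1) => /=.
have e3 : 0 < 3 ^+ k.+1 :> R by rewrite exprn_gt0.
pose eps : R := (2000 * 3 ^+ k.+1)^-1.
have eps0 : 0 < eps.
  by rewrite invr_gt0; apply: mulr_gt0 e3; lra.
have eps3 : eps * 3 ^+ k.+1 = 1 / 2000.
  by rewrite /eps invfM -mulrA (mulVf (lt0r_neq0 e3)) mulr1 div1r.
exists (rounded_cube k eps); split.
- exact: closed_rounded_cube.
- exact: star_shaped_rounded_cube.
- exact: strictly_convex_rounded_cube.
have [M [SM M40]] := moment_rounded_cube k eps0.
have [|A [SA A0]] := @area_rounded_cube R k eps eps0 a (1001 / 1000) a01.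
  move=> q aq; have := gauge_le k eps0 a01' aq; rewrite eps3 => /le_trans; apply.
  by lra.
exists A, M; split=> //.
have {}A0 : 237 / 10 <= A by apply: le_trans A0; rewrite /a; lra.
exact: moment_area_ratio.
Qed.
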